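(* Let $\rho,\sigma$ be $n$-qubit mixed states with $\rho\ge I/\kappa_\rho$ and $\sigma\ge I/\kappa_\sigma$ for known $\kappa_\rho,\kappa_\sigma\ge1$, and let $\mathcal O_\rho,\mathcal O_\sigma$ be unitaries preparing purifications of $\rho$ and $\sigma$. Then there is a quantum algorithm that, for any $\epsilon\in(0,1)$, outputs an estimate of the fidelity $F(\rho,\sigma)$ within additive error $\epsilon$ with probability at least $2/3$, using $\widetilde O\big(\min\{\kappa_\rho^2,\kappa_\sigma^2\}\cdot\kappa_\rho\kappa_\sigma/\epsilon\big)$ queries to $\mathcal O_\rho$ and $\mathcal O_\sigma$.
   Context: The (Uhlmann) fidelity is $F(\rho,\sigma):=\operatorname{Tr}\big((\sigma^{1/2}\rho\sigma^{1/2})^{1/2}\big)$. A unitary $\mathcal O_\rho$ on $n+a$ qubits prepares a purification of $\rho$ if $\operatorname{Tr}_a(\mathcal O_\rho|0\rangle\langle0|\mathcal O_\rho^\dagger)=\rho$, tracing out the $a$ ancilla qubits. A query means one use of any of $\mathcal O$, $\mathcal O^\dagger$, controlled-$\mathcal O$, controlled-$\mathcal O^\dagger$. $\widetilde O(\cdot)$ hides factors polylogarithmic in $\kappa_\rho,\kappa_\sigma,1/\epsilon$. Inequalities are in the Loewner order. *)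

(* Defs.v *)
(* R : realType, complex numbers C := R[i] (mathcomp-real-closed). *)
From HB Require Import structures.
From mathcomp Require Import all_boot all_order all_algebra.
From mathcomp Require Import complex.
From mathcomp Require Import reals.
Unset Printing Implicit Defensive.
Import Order.TTheory GRing.Theory Num.Theory.
Local Open Scope ring_scope.
Local Open Scope sesquilinear_scope.

Lemma exp2_gt0 k : (0 < 2 ^ k)%N.
Proof. by rewrite expn_gt0. Qed.

Section Quantum.
Context {R : realType}.
Local Notation C := (R[i]).

(* the computational basis index |0...0> of a k-qubit register *)
Definition zidx k : 'I_(2 ^ k) := Ordinal (exp2_gt0 k).

(* conjugate transpose: M ^t* *)
Definition psdmx {m} (A : 'M[C]_m) : Prop :=
  A ^t* = A /\ forall v : 'rV[C]_m, 0 <= (v *m A *m v ^t*) 0 0.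

(* Loewner order: A <= B iff B - A is positive semidefinite *)
Definition lowner {m} (A B : 'M[C]_m) : Prop := psdmx (B - A).

Definition density {m} (rho : 'M[C]_m) : Prop := psdmx rho /\ \tr rho = 1.

Definition unitary {m} (U : 'M[C]_m) : Prop := U \is unitarymx.

(* principal (PSD) square root via the spectral decomposition *)
Definition sqrtm {m} (A : 'M[C]_m) : 'M[C]_m :=
  invmx (spectralmx A) *m diag_mx (map_mx sqrtC (spectral_diag A)) *m spectralmx A.

(* Uhlmann fidelity F(rho,sigma) = Tr ((sigma^1/2 rho sigma^1/2)^1/2) *)
Definition fidelity {m} (rho sigma : 'M[C]_m) : C :=
  \tr (sqrtm (sqrtm sigma *m rho *m sqrtm sigma)).

(* index of |s>|t> in n+a qubits: system s (first n qubits, most significant),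
   ancilla t (last a qubits) *)
Definition pidx {n a} (s : 'I_(2 ^ n)) (t : 'I_(2 ^ a)) : 'I_(2 ^ (n + a)) :=
  cast_ord (esym (expnD 2 n a)) (mxvec_index s t).

(* partial trace over the a ancilla qubits *)
Definition ptrace_anc {n a} (M : 'M[C]_(2 ^ (n + a))) : 'M[C]_(2 ^ n) :=
  \matrix_(s, s') \sum_(t < 2 ^ a) M (pidx s t) (pidx s' t).

(* O prepares a purification of rho: Tr_a (O |0><0| O^dagger) = rho *)
Definition prepares_purification {n a} (O : 'M[C]_(2 ^ (n + a))) (rho : 'M[C]_(2 ^ n))
  : Prop :=
  unitary O /\
  ptrace_anc (O *m delta_mx (zidx (n + a)) (zidx (n + a)) *m O ^t*) = rho.

(* ---- query algorithms on a workspace of W qubits ---- *)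
(* an oracle on k qubits acts on the k least significant qubits of the
   workspace; its controlled version is controlled by the (k+1)-th qubit *)
Definition lo k {W} (i : 'I_(2 ^ W)) : 'I_(2 ^ k) := Ordinal (ltn_pmod i (exp2_gt0 k)).
Definition hi k {W} (i : 'I_(2 ^ W)) : nat := (i %/ 2 ^ k)%N.

Definition embed {k} W (O : 'M[C]_(2 ^ k)) : 'M[C]_(2 ^ W) :=
  \matrix_(i, j) if hi k i == hi k j then O (lo k i) (lo k j) else 0.

Definition embed_ctrl {k} W (O : 'M[C]_(2 ^ k)) : 'M[C]_(2 ^ W) :=
  \matrix_(i, j) if hi k i == hi k j then
                   (if odd (hi k i) then O (lo k i) (lo k j)
                    else (lo k i == lo k j)%:R)
                 else 0.

(* a step: an arbitrary (oracle-independent) unitary, or one query to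
   O_rho (first flag true) or O_sigma (false), possibly adjoint (second flag)
   and/or controlled (third flag) *)
Inductive step (W : nat) : Type :=
| UStep of 'M[C]_(2 ^ W)
| QStep of bool & bool & bool.

Record query_algo := QueryAlgo {
  qa_W : nat;                           (* number of workspace qubits *)
  qa_steps : seq (step qa_W);            (* applied left to right *)
  qa_out : 'I_(2 ^ qa_W) -> R            (* classical post-processing of the
                                           final computational-basis measurement *)
}.

Definition is_query {W} (s : step W) : bool := if s is QStep _ _ _ then true else false.

Definition num_queries (A : query_algo) : nat := count is_query (qa_steps A).

(* well-formedness: intermediate steps are unitary and the workspace is large
   enough to hold each oracle's register plus a control qubit *)
Definition valid_algo (ka ks : nat) (A : query_algo) : Prop :=
  (ka < qa_W A)%N /\ (ks < qa_W A)%N /\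
  all (fun s => if s is UStep U then U \is unitarymx else true) (qa_steps A).

Definition oracle_mx {k} W (O : 'M[C]_(2 ^ k)) (adj ctrl : bool) : 'M[C]_(2 ^ W) :=
  let O' := if adj then O ^t* else O in
  if ctrl then embed_ctrl W O' else embed W O'.

Definition step_mx {ka ks W} (Oa : 'M[C]_(2 ^ ka)) (Os : 'M[C]_(2 ^ ks)) (s : step W)
  : 'M[C]_(2 ^ W) :=
  match s with
  | UStep U => U
  | QStep which adj ctrl =>
      if which then oracle_mx W Oa adj ctrl else oracle_mx W Os adj ctrl
  end.

(* final state: steps applied in order to |0...0> *)
Definition final_state {ka ks} (Oa : 'M[C]_(2 ^ ka)) (Os : 'M[C]_(2 ^ ks)) (A : query_algo)
  : 'cV[C]_(2 ^ qa_W A) :=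
  foldl (fun psi s => step_mx Oa Os s *m psi)
        (delta_mx (zidx (qa_W A)) 0) (qa_steps A).

(* probability that the algorithm's output lies in the set P *)
Definition prob_out {ka ks} (Oa : 'M[C]_(2 ^ ka)) (Os : 'M[C]_(2 ^ ks)) (A : query_algo)
  (P : pred R) : C :=
  \sum_(o : 'I_(2 ^ qa_W A) | P (qa_out A o)) `|final_state Oa Os A o 0| ^+ 2.

(* logarithmic size measure: floor(log2 (truncn x)) + 1 >= 1 *)
Definition logsz (x : R) : nat := (trunc_log 2 (Num.truncn x)).+1.

End Quantum.

(* Main.v *)
(* The hypotheses force the dimension d = 2^n to be at most min(kr, ks), since a
   state with all eigenvalues at least 1/k has trace at least d/k. Full tomography
   of both states therefore fits in the budget, provided every matrix entry is
   learnt with Heisenberg-limited precision.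

   For a rank-one projector P put p = Tr(P rho), and let V be a fixed reflection
   whose block at |0> of an extra register is (3/5)(1 - P) + (4/5)P. Then
   B = O^* V O is a reflection with <0|B|0> = x = (3 + p)/5, and alternating B with
   the reflection about |0> gives amplitudes <0|(B S)^k|0> = T_k(x) by the Chebyshev
   recurrence. So k iterations (2k queries) yield a coin of bias
   T_k(x)^2 = (1 + Re y^k)/2, where y = (x + i sqrt(1 - x^2))^2. Tossing coins for
   k = 2^j and k = 2^j + 1, j <= m, determines y^(2^j) to precision 1/m for every j,
   and |u - v| = |u^2 - v^2|/|u + v| propagates this to precision O(2^-m) for y,
   hence for p.

   The projectors onto e_s + e_t and e_s + i e_t give all entries of the states.
   The classical post-processing returns the fidelity of any admissible pair of
   states consistent with the coins; it is accurate because of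
   |F(rho,sigma) - F(rho',sigma')| <= |sqrt rho - sqrt rho'|_2 + |sqrt sigma - sqrt sigma'|_2
   and |sqrt rho - sqrt rho'|_2 <= (k/2) |rho - rho'|_2 when rho, rho' >= 1/k. *)
Require Import Defs.
From HB Require Import structures.
From mathcomp Require Import all_boot all_order all_algebra.
From mathcomp Require Import complex.
From mathcomp Require Import reals.
From mathcomp Require Import boolp sequences exp.
From mathcomp Require Import zify ring lra.
Import Order.TTheory GRing.Theory Num.Theory.
Local Open Scope ring_scope.
Local Open Scope sesquilinear_scope.
Set Implicit Arguments.
Unset Strict Implicit.

(** * Registers and tensor products *)

Section Registers.
Context {R : realType}.
Local Notation C := (R[i]).

Lemma hi_lt k e W (i : 'I_(2 ^ W)) : W = (e + k)%N -> (hi k i < 2 ^ e)%N.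
Proof. by move=> E; rewrite /hi ltn_divLR ?expn_gt0 // -expnD -E. Qed.

Definition hio {k e W} (E : W = (e + k)%N) (i : 'I_(2 ^ W)) : 'I_(2 ^ e) :=
  Ordinal (hi_lt i E).

Lemma join_lt k e W (h : 'I_(2 ^ e)) (l : 'I_(2 ^ k)) :
  W = (e + k)%N -> (h * 2 ^ k + l < 2 ^ W)%N.
Proof.
move=> ->; rewrite expnD; apply: leq_trans (_ : h.+1 * 2 ^ k <= _)%N.
  by rewrite mulSn addnC ltn_add2r.
by rewrite leq_mul2r ltn_ord orbT.
Qed.

Definition join {k e W} (E : W = (e + k)%N) (h : 'I_(2 ^ e)) (l : 'I_(2 ^ k)) : 'I_(2 ^ W) :=
  Ordinal (join_lt h l E).

Lemma joinK k e W (E : W = (e + k)%N) i : join E (hio E i) (lo k i) = i.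
Proof. by apply/val_inj; rewrite /= /hi -divn_eq. Qed.

Lemma hi_join k e W (E : W = (e + k)%N) h l : hi k (join E h l) = h.
Proof. by rewrite /hi /= divnMDl ?expn_gt0 // divn_small ?addn0. Qed.

Lemma hio_join k e W (E : W = (e + k)%N) h l : hio E (join E h l) = h.
Proof. by apply/val_inj; rewrite /= hi_join. Qed.

Lemma lo_join k e W (E : W = (e + k)%N) h l : lo k (join E h l) = l.
Proof. by apply/val_inj; rewrite /= modnMDl modn_small. Qed.

Lemma sum_join k e W (E : W = (e + k)%N) (V : nmodType) (F : 'I_(2 ^ W) -> V) :
  \sum_i F i = \sum_h \sum_l F (join E h l).
Proof.
rewrite pair_big /= (reindex (fun p : 'I_(2 ^ e) * 'I_(2 ^ k) => join E p.1 p.2)) //=.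
exists (fun i => (hio E i, lo k i)) => [[h l] _|i _] /=; last exact: joinK.
by rewrite hio_join lo_join.
Qed.

Lemma join_eq k e W (E : W = (e + k)%N) h l h' l' :
  (join E h l == join E h' l') = (h == h') && (l == l').
Proof.
apply/eqP/andP => [H|[/eqP -> /eqP ->//]].
have := congr1 (hio E) H; have := congr1 (lo k) H.
by rewrite !hio_join !lo_join => -> ->.
Qed.

(** The first factor sits on the high qubits, the second on the low ones, where oracles act; [embed]
    is the case of an identity first factor. *)
Definition tens {k e W} (E : W = (e + k)%N) (A : 'M[C]_(2 ^ e)) (B : 'M[C]_(2 ^ k))
  : 'M[C]_(2 ^ W) :=
  \matrix_(i, j) (A (hio E i) (hio E j) * B (lo k i) (lo k j)).

Section Tens.
Context {k e W : nat} (E : W = (e + k)%N).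
Implicit Types (A : 'M[C]_(2 ^ e)) (B : 'M[C]_(2 ^ k)).

Lemma tens_mul A A' B B' : tens E A B *m tens E A' B' = tens E (A *m A') (B *m B').
Proof.
apply/matrixP => i j; rewrite !mxE (sum_join E) big_distrlr /=.
apply: eq_bigr => h _; apply: eq_bigr => l _.
by rewrite !mxE hio_join lo_join mulrACA.
Qed.

Lemma tens_trC A B : (tens E A B) ^t* = tens E (A ^t*) (B ^t*).
Proof. by apply/matrixP => i j; rewrite !mxE rmorphM. Qed.

Lemma tens1 : tens E 1%:M 1%:M = 1%:M.
Proof.
apply/matrixP => i j; rewrite !mxE -[in RHS](joinK E i) -[in RHS](joinK E j).
by rewrite join_eq; case: eqP => _; case: eqP => _; rewrite ?mulr1 ?mulr0.
Qed.

Lemma tensDr A B B' : tens E A (B + B') = tens E A B + tens E A B'.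
Proof. by apply/matrixP => i j; rewrite !mxE mulrDr. Qed.

Lemma tens0r A : tens E A 0 = 0.
Proof. by apply/matrixP => i j; rewrite !mxE mulr0. Qed.

Lemma embedE B : embed W B = tens E 1%:M B.
Proof.
apply/matrixP => i j; rewrite !mxE.
rewrite (_ : (hio E i == hio E j) = (hi k i == hi k j)) //.
by case: eqP; rewrite ?mul1r ?mul0r.
Qed.

Lemma embed_unitary B : B \is unitarymx -> embed W B \is unitarymx.
Proof.
move=> /unitarymxP uB; apply/unitarymxP.
by rewrite embedE tens_trC tens_mul uB trmx1 map_mx1 mulmx1 tens1.
Qed.

Lemma embed_mul B B' : embed W (B *m B') = embed W B *m embed W B'.
Proof. by rewrite !embedE tens_mul mulmx1. Qed.

Lemma embed_trC B : (embed W B) ^t* = embed W (B ^t*).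
Proof. by rewrite !embedE tens_trC trmx1 map_mx1. Qed.

(** The first argument is the state of the low register, the reverse of the order in [tens]. *)
Definition pstate (a : 'cV[C]_(2 ^ k)) (b : 'cV[C]_(2 ^ e)) : 'cV[C]_(2 ^ W) :=
  \col_i (a (lo k i) 0 * b (hio E i) 0).

Lemma embed_pstate B a b : embed W B *m pstate a b = pstate (B *m a) b.
Proof.
apply/matrixP => i c; rewrite !mxE embedE (sum_join E) big_distrl /=.
rewrite exchange_big /=; apply: eq_bigr => l _.
rewrite (bigD1 (hio E i)) //= big1 ?addr0 => [|h hi]; rewrite !mxE hio_join lo_join.
  by rewrite eqxx mul1r mulrA.
by rewrite eq_sym (negPf hi) !mul0r.
Qed.

Lemma pstate_zero : pstate (delta_mx (zidx k) 0) (delta_mx (zidx e) 0) = delta_mx (zidx W) 0.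
Proof.
apply/matrixP => i j; rewrite !mxE ord1 eqxx !andbT -natrM mulnb.
rewrite -[in RHS](joinK E i); have -> : zidx W = join E (zidx e) (zidx k) by apply/val_inj.
by rewrite join_eq andbC.
Qed.

End Tens.

(** * Registers nested inside registers *)

Section EmbedEmbed.
Variables (k m W : nat) (km : (k <= m)%N) (mW : (m <= W)%N).

Lemma lo_lo (i : 'I_(2 ^ W)) : lo k (lo m i) = lo k i.
Proof. by apply/val_inj => /=; rewrite modn_dvdm // dvdn_exp2l. Qed.

Lemma hi_split (i : 'I_(2 ^ W)) : hi k i = (hi m i * 2 ^ (m - k) + hi k (lo m i))%N.
Proof.
rewrite /hi /= {1}(divn_eq i (2 ^ m)) -{2}(subnK km) expnD mulnA divnMDl //.
by rewrite expn_gt0.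
Qed.

Lemma hi_lo_lt (i : 'I_(2 ^ W)) : (hi k (lo m i) < 2 ^ (m - k))%N.
Proof. by rewrite /hi ltn_divLR ?expn_gt0 // -expnD subnK. Qed.

Lemma hi_eq (i j : 'I_(2 ^ W)) :
  (hi k i == hi k j) = (hi m i == hi m j) && (hi k (lo m i) == hi k (lo m j)).
Proof.
rewrite !hi_split; apply/eqP/andP => [H|[/eqP -> /eqP ->//]].
have P : (0 < 2 ^ (m - k))%N by rewrite expn_gt0.
have := congr1 (fun x => x %/ 2 ^ (m - k))%N H.
have := congr1 (fun x => x %% 2 ^ (m - k))%N H.
rewrite /= !modnMDl !divnMDl // !modn_small ?hi_lo_lt // !divn_small ?hi_lo_lt //.
by rewrite !addn0 => -> ->.
Qed.

Lemma embed_embed (O : 'M[C]_(2 ^ k)) : embed W (embed m O) = embed W O.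
Proof. by apply/matrixP => i j; rewrite !mxE hi_eq !lo_lo; case: (_ == _). Qed.

Lemma embed_embed_ctrl (O : 'M[C]_(2 ^ k)) : (k < m)%N ->
  embed W (embed_ctrl m O) = embed_ctrl W O.
Proof.
move=> lt_km; apply/matrixP => i j; rewrite !mxE hi_eq !lo_lo.
(* The control is the lowest bit of [hi k i]; as [k < m] is strict, the qubits beyond [m] contribute
   an even number. *)
have -> : odd (hi k i) = odd (hi k (lo m i)).
  by rewrite hi_split oddD oddM oddX /= orbF subn_eq0 leqNgt lt_km andbF.
by case: (_ == _).
Qed.
End EmbedEmbed.

Definition lift_step {m} W (s : step m) : @step R W :=
  match s with UStep U => UStep W (embed W U) | QStep a b c => QStep W a b c end.

Lemma lift_stepE ka ks m W (Oa : 'M[C]_(2 ^ ka)) (Os : 'M[C]_(2 ^ ks)) (s : step m) :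
  (ka < m)%N -> (ks < m)%N -> (m <= W)%N ->
  step_mx Oa Os (lift_step W s) = embed W (step_mx Oa Os s).
Proof.
move=> ham hsm mW; case: s => [U|[] [] []] //=; rewrite /oracle_mx /=.
all: by rewrite ?embed_embed ?embed_embed_ctrl // ltnW.
Qed.

Definition run {ka ks W} (Oa : 'M[C]_(2 ^ ka)) (Os : 'M[C]_(2 ^ ks)) (l : seq (@step R W))
  (psi : 'cV[C]_(2 ^ W)) := foldl (fun psi s => step_mx Oa Os s *m psi) psi l.

Lemma run_cat ka ks W (Oa : 'M[C]_(2 ^ ka)) (Os : 'M[C]_(2 ^ ks)) (l l' : seq (@step R W)) psi :
  run Oa Os (l ++ l') psi = run Oa Os l' (run Oa Os l psi).
Proof. exact: foldl_cat. Qed.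

Lemma run_ustep ka ks W (Oa : 'M[C]_(2 ^ ka)) (Os : 'M[C]_(2 ^ ks)) U (l : seq (@step R W)) psi :
  run Oa Os (UStep W U :: l) psi = run Oa Os l (U *m psi).
Proof. by []. Qed.

Lemma run_lift ka ks m e W (E : W = (e + m)%N) (Oa : 'M[C]_(2 ^ ka)) (Os : 'M[C]_(2 ^ ks)) l a b :
  (ka < m)%N -> (ks < m)%N ->
  run Oa Os [seq lift_step W s | s <- l] (pstate E a b) = pstate E (run Oa Os l a) b.
Proof.
move=> ham hsm; rewrite /run; elim: l a => //= s l IH a.
rewrite lift_stepE //; last by rewrite E leq_addl.
by rewrite embed_pstate IH.
Qed.

Definition unitary_step {W} (s : @step R W) :=
  if s is UStep U then U \is unitarymx else true.

Lemma all_lift m e W (E : W = (e + m)%N) (l : seq (@step R m)) :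
  all unitary_step l -> all unitary_step [seq lift_step W s | s <- l].
Proof.
rewrite all_map; apply: sub_all => -[U|] //=; exact: (embed_unitary E).
Qed.

Lemma count_lift m W (l : seq (@step R m)) :
  count is_query [seq lift_step W s | s <- l] = count is_query l.
Proof. by rewrite count_map; apply: eq_count => -[]. Qed.

(** Queries only reach the lowest qubits, so a second circuit gets a fresh register by exchanging it
    with the used one. *)
Definition swapmx m e W (E : W = (e + m)%N) (E' : W = (m + e)%N) : 'M[C]_(2 ^ W) :=
  \matrix_(i, j) (j == join E (lo e i) (hio E' i))%:R.

Lemma swap_pstate m e W (E : W = (e + m)%N) (E' : W = (m + e)%N) a b :
  swapmx E E' *m pstate E a b = pstate E' b a.
Proof.
apply/matrixP => i c; rewrite !mxE (bigD1 (join E (lo e i) (hio E' i))) //= big1.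
  by rewrite !mxE eqxx mul1r addr0 lo_join hio_join mulrC.
by move=> j /negPf jN; rewrite !mxE jN mul0r.
Qed.

Lemma swap_unitary m e W (E : W = (e + m)%N) (E' : W = (m + e)%N) :
  swapmx E E' \is unitarymx.
Proof.
apply/unitarymxP/matrixP => i j; rewrite !mxE (bigD1 (join E (lo e i) (hio E' i))) //= big1.
  rewrite !mxE eqxx mul1r addr0 join_eq conjC_nat; congr (nat_of_bool _)%:R.
  by rewrite -{3}(joinK E' i) -{3}(joinK E' j) join_eq andbC.
by move=> l /negPf lN; rewrite !mxE lN mul0r.
Qed.
End Registers.

(** * Independent runs in parallel *)

Section Realizable.
Context {R : realType} (ka ks : nat).
Local Notation C := (R[i]).
Implicit Types (Oa : 'M[C]_(2 ^ ka)) (Os : 'M[C]_(2 ^ ks)).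

(** The law is a function of the two oracle matrices, so circuits compose before any state is fixed;
    the query count is exact, so counts add. *)
Definition realizes (q : nat) (T : finType)
  (D : 'M[C]_(2 ^ ka) -> 'M[C]_(2 ^ ks) -> T -> C) : Prop :=
  exists (W : nat) (l : seq (@step R W)) (f : 'I_(2 ^ W) -> T),
    [/\ (ka < W)%N, (ks < W)%N, all unitary_step l, count is_query l = q &
      forall Oa Os t,
        \sum_(o | f o == t) `|run Oa Os l (delta_mx (zidx W) 0) o 0| ^+ 2 = D Oa Os t].

(** Run one circuit, exchange the registers, run the other: the final state is a product state, so
    outcome probabilities multiply. *)
Lemma realizes_prod q1 q2 (T1 T2 : finType) D1 D2 :
  @realizes q1 T1 D1 -> @realizes q2 T2 D2 ->
  @realizes (q1 + q2) (T1 * T2)%type (fun Oa Os t => D1 Oa Os t.1 * D2 Oa Os t.2).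
Proof.
move=> [W1 [l1 [f1 [a1 s1 u1 <- H1]]]] [W2 [l2 [f2 [a2 s2 u2 <- H2]]]].
pose W := (W2 + W1)%N.
have E1 : W = (W2 + W1)%N by []; have E2 : W = (W1 + W2)%N by rewrite addnC.
exists W, ([seq lift_step W s | s <- l1] ++ UStep W (swapmx E1 E2)
            :: [seq lift_step W s | s <- l2]), (fun i => (f1 (hio E2 i), f2 (lo W2 i))).
split.
- by rewrite E1 ltn_addl.
- by rewrite E1 ltn_addl.
- by rewrite all_cat /= swap_unitary (all_lift E1) // (all_lift E2).
- by rewrite count_cat /= add0n !count_lift.
move=> Oa Os [t1 t2] /=.
rewrite run_cat run_ustep -(pstate_zero E1) run_lift // swap_pstate run_lift // -H1 -H2.
rewrite big_mkcond (sum_join E2) big_distrlr /= [RHS]big_mkcond /=.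
apply: eq_bigr => h _; rewrite [in RHS]big_mkcond /=.
case: (f1 h == t1) / eqP => H; last first.
  by apply: big1 => l _; rewrite hio_join xpair_eqE (introF eqP H).
apply: eq_bigr => l _; rewrite hio_join lo_join xpair_eqE H eqxx /=.
by case: ifP => // _; rewrite !mxE hio_join lo_join normrM exprMn mulrC.
Qed.

Lemma realizes_map q (T T' : finType) D (g : T -> T') :
  @realizes q T D -> @realizes q T' (fun Oa Os t' => \sum_(t | g t == t') D Oa Os t).
Proof.
move=> [W [l [f [aW sW u cq H]]]]; exists W, l, (g \o f); split=> // Oa Os t'.
rewrite (partition_big f (fun t => g t == t')) //=.
apply: eq_bigr => t /eqP gt; rewrite -H; apply: eq_bigl => o.
by rewrite /= andbC; case: (f o =P t) => [->|] //=; rewrite gt eqxx.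
Qed.

Lemma eq_realizes q (T : finType) D D' :
  (forall Oa Os t, D Oa Os t = D' Oa Os t) -> @realizes q T D -> @realizes q T D'.
Proof.
move=> e [W [l [f [aW sW u cq H]]]]; exists W, l, f; split=> // Oa Os t.
by rewrite H e.
Qed.

Lemma realizes_point (T : finType) (t0 : T) :
  @realizes 0 T (fun _ _ t => (t == t0)%:R).
Proof.
exists (ka + ks).+1, [::], (fun=> t0); split=> //; rewrite ?ltnS ?leq_addr ?leq_addl //.
move=> Oa Os t /=; rewrite eq_sym; case: (t == t0); last by rewrite big_pred0.
rewrite (bigD1 (zidx _)) //= big1 ?mxE ?eqxx /= ?normr1 ?expr1n ?addr0 // => i iN.
by rewrite mxE (negPf iN) normr0 expr0n.
Qed.

Lemma realizes_ffun (I : finType) (q : I -> nat) D :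
  (forall i, @realizes (q i) bool (D i)) ->
  @realizes (\sum_i q i) {ffun I -> bool} (fun Oa Os x => \prod_i D i Oa Os (x i)).
Proof.
move=> HD.
(* Coordinates outside [s] are pinned to false, which keeps the outcome type fixed while the
   induction adds one coin at a time. *)
suff H (s : seq I) : uniq s -> @realizes (\sum_(i <- s) q i) {ffun I -> bool}
    (fun Oa Os x => \prod_i if i \in s then D i Oa Os (x i) else (x i == false)%:R).
  have := H (index_enum I) (index_enum_uniq I).
  apply: eq_realizes => Oa Os x; apply: eq_bigr => i _.
  by rewrite mem_index_enum.
elim: s => [_|i s IH /= /andP [iNs us]].
  rewrite big_nil; apply: eq_realizes (realizes_point [ffun=> false]) => Oa Os x /=.
  case: eqP => [->|/eqP xN].
    by rewrite big1 // => i _; rewrite ffunE eqxx.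
  have [i xi] : exists i, x i.
    apply/existsP; apply: contraNT xN => /existsPn xN; apply/eqP/ffunP => i.
    by rewrite ffunE; apply/negbTE/xN.
  by rewrite (bigD1 i) //= xi mul0r.
rewrite big_cons.
pose upd (p : bool * {ffun I -> bool}) : {ffun I -> bool} :=
  [ffun j => if j == i then p.1 else p.2 j].
apply: eq_realizes (realizes_map upd (realizes_prod (HD i) (IH us))) => Oa Os x /=.
(* Among the pairs that [upd] sends to [x], only the one whose second part is false at [i] can carry
   weight, since [i] is not in [s]. *)
rewrite (bigD1 (x i, [ffun j => if j == i then false else x j])) /=; last first.
  by apply/eqP/ffunP => j; rewrite !ffunE /=; case: eqP => [->|].
rewrite [X in _ + X]big1 ?addr0 => [|[b y] /= /andP [/eqP uE yN]].
  rewrite [RHS](bigD1 i) //= inE eqxx /=; congr (_ * _).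
  rewrite (bigD1 i) //= (negPf iNs) ffunE !eqxx mul1r.
  apply: eq_bigr => j jN; rewrite ffunE (negPf jN) inE (negPf jN) //.
rewrite (bigD1 i) //= (negPf iNs).
case yi: (y i); first by rewrite mul0r mulr0.
case/negP: yN; rewrite xpair_eqE -uE ffunE eqxx eqxx /=; apply/eqP/ffunP => j.
by rewrite !ffunE; case: eqP => [->|].
Qed.

Lemma realizes_algo q (T : finType) D (out : T -> R) : @realizes q T D ->
  exists A : @query_algo R, [/\ valid_algo ka ks A, num_queries A = q &
    forall Oa Os (P : pred R), prob_out Oa Os A P = \sum_(t | P (out t)) D Oa Os t].
Proof.
move=> [W [l [f [aW sW u cq H]]]]; exists (QueryAlgo W l (out \o f)); split=> //.
move=> Oa Os P; rewrite /prob_out /=.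
rewrite (partition_big f (fun t => P (out t))) //=.
apply: eq_bigr => t Pt; rewrite -H; apply: eq_bigl => o.
by rewrite /= andbC; case: (f o =P t) => [->|] //=; rewrite Pt.
Qed.
End Realizable.

(** * Chebyshev walk *)

Section Walk.
Context {R : realType}.
Local Notation C := (R[i]).

(** For |x| <= 1, the point of the unit circle with cosine [x]: the real part of its k-th power is
    the Chebyshev value T_k(x). *)
Definition zof (x : R) : C := (x +i* Num.sqrt (1 - x ^+ 2))%C.

Lemma zof_rec (x : R) k : -1 <= x <= 1 ->
  complex.Re (zof x ^+ k.+2) = 2 * x * complex.Re (zof x ^+ k.+1) - complex.Re (zof x ^+ k).
Proof.
move=> x1; have H : zof x ^+ 2 = (2 * x)%:C%C * zof x - 1.
  have S : Num.sqrt (1 - x ^+ 2) ^+ 2 = 1 - x ^+ 2 by rewrite sqr_sqrtr //; nra.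
  rewrite expr2; apply/eqP; rewrite eq_complex /=; apply/andP; split; apply/eqP.
    by rewrite -!expr2 S; ring.
  by ring.
rewrite -[k.+2]addn2 exprD H mulrBr mulr1 mulrCA -exprSr.
by case: (_ ^+ k.+1) => a b; case: (_ ^+ k) => c d /=; ring.
Qed.

Variables (D : nat) (B : 'M[C]_D) (z : 'I_D).
Hypothesis BB : B *m B = 1%:M.

Definition zrefl : 'M[C]_D := 2 *: delta_mx z z - 1%:M.

Definition walk (psi : 'cV[C]_D) := B *m (zrefl *m psi).

Lemma zreflE (psi : 'cV[C]_D) : zrefl *m psi = (2 * psi z 0) *: delta_mx z 0 - psi.
Proof.
rewrite mulmxBl mul1mx -scalemxAl -scalerA; congr (_ *: _ - _).
apply/matrixP => i j; rewrite !mxE (bigD1 z) //= big1 => [|l lN].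
  by rewrite !mxE ord1 eqxx addr0 !andbT mulrC.
by rewrite !mxE (negPf lN) andbF mul0r.
Qed.

Lemma zrefl_sq : zrefl *m zrefl = 1%:M.
Proof.
rewrite mulmxBl mul1mx -scalemxAl mulmxBr mulmx1 -scalemxAr mul_delta_mx.
by apply/matrixP => i j; rewrite !mxE; ring.
Qed.

Lemma zrefl_trC : zrefl ^t* = zrefl.
Proof.
apply/matrixP => i j; by rewrite !mxE rmorphB rmorphM !rmorph_nat andbC (eq_sym j i).
Qed.

Lemma walk0 : walk (delta_mx z 0) = B *m delta_mx z 0.
Proof. by rewrite /walk zreflE mxE !eqxx mulr1 (_ : 2 = 1 + 1) // scalerDl scale1r addrK. Qed.

Lemma mul_delta00 : (B *m delta_mx z 0 :> 'cV_D) z 0 = B z z.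
Proof.
rewrite !mxE (bigD1 z) //= big1 ?mxE ?eqxx ?mulr1 ?addr0 // => l lN.
by rewrite mxE (negPf lN) mulr0.
Qed.

(* B and zrefl generate a dihedral group acting on the plane spanned by |z> and
   B|z>, so the orbit of |z> satisfies the Chebyshev recurrence. *)
Lemma walk_rec k :
  iter k.+2 walk (delta_mx z 0) =
    (2 * B z z) *: iter k.+1 walk (delta_mx z 0) - iter k walk (delta_mx z 0).
Proof.
have walk_lin c a b : walk (c *: a - b) = c *: walk a - walk b.
  by rewrite /walk !mulmxBr -!scalemxAr.
elim: k => [|k IH]; first last.
  by rewrite [LHS]iterS [in LHS]IH walk_lin -!iterS.
by rewrite /= walk0 /walk zreflE mulmxBr -scalemxAr mulmxA BB mul1mx mul_delta00.
Qed.

Lemma walk_amplitude (x : R) k : -1 <= x <= 1 -> B z z = x%:C%C ->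
  iter k walk (delta_mx z 0) z 0 = (complex.Re (zof x ^+ k))%:C%C.
Proof.
move=> x1 Bz; suff [] : iter k walk (delta_mx z 0) z 0 = (complex.Re (zof x ^+ k))%:C%C /\
  iter k.+1 walk (delta_mx z 0) z 0 = (complex.Re (zof x ^+ k.+1))%:C%C by [].
elim: k => [|k [IH0 IH1]].
  split; first by rewrite expr0 /= mxE !eqxx.
  by rewrite expr1 /= walk0 mul_delta00 Bz.
split=> //; rewrite walk_rec mxE [X in X + _]mxE [X in _ + X]mxE IH0 IH1 Bz zof_rec //.
by rewrite rmorphB !rmorphM /= (_ : 2%:C%C = 2) // rmorph_nat.
Qed.
End Walk.

(** * Reflections and projectors *)

Section Reflections.
Context {R : realType}.
Local Notation C := (R[i]).

Definition outer {D} (u : 'cV[C]_D) : 'M[C]_D := u *m u ^t*.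

Lemma outer_trC D (u : 'cV[C]_D) : (outer u) ^t* = outer u.
Proof. by rewrite /outer trmx_mul map_mxM trmxCK. Qed.

Lemma outer_idem D (u : 'cV[C]_D) : u ^t* *m u = 1%:M -> outer u *m outer u = outer u.
Proof. by move=> u1; rewrite /outer mulmxA -(mulmxA u) u1 mulmx1. Qed.

Lemma refl_idem D (P : 'M[C]_D) : P *m P = P -> (1%:M - 2 *: P) *m (1%:M - 2 *: P) = 1%:M.
Proof.
move=> PP; rewrite mulmxBl mul1mx -scalemxAl mulmxBr mulmx1 -scalemxAr PP.
apply/matrixP => i j; rewrite !mxE; ring.
Qed.

Lemma refl_trC D (P : 'M[C]_D) : P ^t* = P -> (1%:M - 2 *: P) ^t* = 1%:M - 2 *: P.
Proof.
move=> PP; rewrite -{2}PP; apply/matrixP => i j.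
by rewrite !mxE rmorphB rmorphM !rmorph_nat (eq_sym j i).
Qed.

(** Reflect along a unit vector in the plane of [z] and a second basis vector: with [z]-component
    [al] the corner is 1 - 2 al^2, and this is solved for [al]. *)
Lemma reflection_corner D (z : 'I_D) (c : R) : (1 < D)%N -> -1 <= c <= 1 ->
  exists Q : 'M[C]_D, [/\ Q *m Q = 1%:M, Q ^t* = Q & Q z z = c%:C%C].
Proof.
move=> D1 c1.
have [w wz] : exists w : 'I_D, w != z.
  have [zE|zN] := eqVneq (val z) 0%N.
    by exists (Ordinal D1); rewrite -val_eqE /= zE.
  by exists (Ordinal (ltnW D1)); rewrite -val_eqE /= eq_sym.
pose al := Num.sqrt ((1 - c) / 2); pose be := Num.sqrt ((1 + c) / 2).
have al2 : al * al = (1 - c) / 2 by rewrite -expr2 sqr_sqrtr //; lra.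
have be2 : be * be = (1 + c) / 2 by rewrite -expr2 sqr_sqrtr //; lra.
pose u : 'cV[C]_D := al%:C%C *: delta_mx z 0 + be%:C%C *: delta_mx w 0.
have uz : u z 0 = al%:C%C by rewrite !mxE !eqxx eq_sym (negPf wz) mulr1 mulr0 addr0.
have uw : u w 0 = be%:C%C by rewrite !mxE !eqxx (negPf wz) mulr1 mulr0 add0r.
have realK (a : R) : (a%:C%C : C)^* = a%:C%C by apply/CrealP/complex_realP; exists a.
have uC l : (u ^t*) 0 l = (u l 0)^* by rewrite mxE mxE.
have u1 : u ^t* *m u = 1%:M.
  apply/matrixP => i j; rewrite !ord1 mxE (bigD1 z) //= (bigD1 w) //= big1; last first.
    by move=> l /andP [lz lw]; rewrite !mxE (negPf lz) (negPf lw) !mulr0 addr0 mulr0.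
  rewrite addr0 !uC uz uw !realK -!rmorphM -rmorphD al2 be2 /= mxE eqxx.
  by have -> : (1 - c) / 2 + (1 + c) / 2 = 1 by field.
exists (1%:M - 2 *: outer u); split.
- exact/refl_idem/outer_idem.
- exact/refl_trC/outer_trC.
rewrite mxE mxE eqxx mxE mxE mxE big_ord1 uC uz realK -rmorphM al2.
apply/eqP; rewrite eq_complex /=; apply/andP; split; apply/eqP; last by ring.
by field.
Qed.

(** By idempotence and cyclicity this is the trace of P rho P^*, a sum of quadratic forms of rho on
    the rows of P. *)
Lemma tr_proj_ge0 D (rho P : 'M[C]_D) : psdmx rho -> P *m P = P -> P ^t* = P ->
  0 <= \tr (P *m rho).
Proof.
move=> [_ prho] PP PH; rewrite -PP -mulmxA mxtrace_mulC.
rewrite -{2}PH; apply: sumr_ge0 => i _; have := prho (row i P).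
congr (0 <= _); rewrite -row_mul !mxE; apply: eq_bigr => j _; by rewrite !mxE.
Qed.
End Reflections.

(** * Block encoding of a projector *)

Section PurifiedSystem.
Context {R : realType} {n a : nat}.
Local Notation C := (R[i]).

Definition unpidx (i : 'I_(2 ^ (n + a))) : 'I_(2 ^ n) * 'I_(2 ^ a) :=
  enum_val (cast_ord (esym (mxvec_cast _ _)) (cast_ord (expnD 2 n a) i)).

Lemma pidxK s t : unpidx (pidx s t) = (s, t).
Proof. by rewrite /unpidx /pidx cast_ordKV /mxvec_index cast_ordK enum_rankK. Qed.

Lemma unpidxK i : pidx (unpidx i).1 (unpidx i).2 = i.
Proof.
rewrite /pidx /mxvec_index -surjective_pairing /unpidx enum_valK cast_ordKV.
by apply/val_inj.
Qed.

Lemma sum_pidx (V : nmodType) (F : 'I_(2 ^ (n + a)) -> V) :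
  \sum_i F i = \sum_s \sum_t F (pidx s t).
Proof.
rewrite pair_big /= (reindex (fun p : 'I_(2 ^ n) * 'I_(2 ^ a) => pidx p.1 p.2)) //=.
by exists unpidx => [[s t] _|i _] /=; rewrite ?pidxK ?unpidxK.
Qed.

(** P tensor the identity on the ancilla, written through the indexing [pidx] of the partial
    trace. *)
Definition liftsys (P : 'M[C]_(2 ^ n)) : 'M[C]_(2 ^ (n + a)) :=
  \matrix_(i, j) (P (unpidx i).1 (unpidx j).1 * ((unpidx i).2 == (unpidx j).2)%:R).

Lemma liftsys_mul P Q : liftsys P *m liftsys Q = liftsys (P *m Q).
Proof.
apply/matrixP => i j; rewrite !mxE sum_pidx big_distrl /=.
apply: eq_bigr => s _; rewrite (bigD1 (unpidx i).2) //= big1 => [|t tN].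
  by rewrite !mxE pidxK /= eqxx mulr1 addr0 mulrA.
by rewrite !mxE pidxK /= eq_sym (negPf tN) mulr0 mul0r.
Qed.

Lemma liftsys_trC P : (liftsys P) ^t* = liftsys (P ^t*).
Proof. by apply/matrixP => i j; rewrite !mxE rmorphM rmorph_nat eq_sym. Qed.

(** A measurement on the system part of a purification sees only the reduced state. *)
Lemma liftsys_expectation (O : 'M[C]_(2 ^ (n + a))) rho (P : 'M[C]_(2 ^ n)) :
  prepares_purification O rho ->
  let psi := O *m delta_mx (zidx _) 0 :> 'cV[C]_(2 ^ (n + a)) in
  (psi ^t* *m (liftsys P *m psi)) 0 0 = \tr (P *m rho).
Proof.
move=> [_ <-] psi.
have OE : O *m delta_mx (zidx (n + a)) (zidx (n + a)) *m O ^t* = psi *m psi ^t*.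
  rewrite /psi trmx_mul map_mxM mulmxA -[in RHS](mulmxA O).
  congr (_ *m _ *m _); apply/matrixP => i j; rewrite !mxE big_ord1 !mxE eqxx andbT.
  by rewrite rmorph_nat -natrM mulnb !andbT.
rewrite OE; clear OE; clearbody psi; rewrite mxE sum_pidx /mxtrace.
have psiC l : (psi ^t*) 0 l = (psi l 0)^* by rewrite mxE mxE.
under eq_bigr => s _ do under eq_bigr => t _ do rewrite psiC mxE sum_pidx big_distrr /=.
apply: eq_bigr => s _; rewrite mxE exchange_big /=; apply: eq_bigr => s' _.
rewrite mxE big_distrr /=; apply: eq_bigr => t _.
rewrite (bigD1 t) //= big1 ?addr0 => [|t' tN]; last first.
  by rewrite mxE !pidxK /= eq_sym (negPf tN) mulr0 mul0r.
by rewrite mxE !pidxK /= eqxx mulr1 mxE big_ord1 psiC; ring.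
Qed.
End PurifiedSystem.

Section ProductStates.
Context {R : realType} {k e W : nat} (E : W = (e + k)%N).
Local Notation C := (R[i]).

Lemma tens_pstate (A : 'M[C]_(2 ^ e)) (B : 'M[C]_(2 ^ k)) a b :
  tens E A B *m pstate E a b = pstate E (B *m a) (A *m b).
Proof.
apply/matrixP => i c; rewrite !mxE (sum_join E) mulrC big_distrlr /=.
by apply: eq_bigr => h _; apply: eq_bigr => l _; rewrite !mxE hio_join lo_join; ring.
Qed.

Lemma pstate_dot (a a' : 'cV[C]_(2 ^ k)) (b b' : 'cV[C]_(2 ^ e)) :
  ((pstate E a b) ^t* *m pstate E a' b') 0 0 = (a ^t* *m a') 0 0 * (b ^t* *m b') 0 0.
Proof.
rewrite !mxE (sum_join E) mulrC big_distrlr /=.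
by apply: eq_bigr => h _; apply: eq_bigr => l _; rewrite !mxE hio_join lo_join rmorphM; ring.
Qed.

Lemma corner_dot D (A : 'M[C]_D) (z : 'I_D) :
  ((delta_mx z 0 : 'cV[C]_D) ^t* *m (A *m delta_mx z 0 : 'cV[C]_D)) 0 0 = A z z.
Proof.
rewrite mxE (bigD1 z) //= big1 => [|l lN]; rewrite !mxE ?eqxx ?(negPf lN) ?rmorph_nat ?mul0r //.
rewrite mul1r addr0 (bigD1 z) //= big1 => [|l lN]; rewrite !mxE ?eqxx ?(negPf lN) ?mulr0 //.
by rewrite mulr1 addr0.
Qed.

Lemma unitary_refl D (Q : 'M[C]_D) : Q *m Q = 1%:M -> Q ^t* = Q -> Q \is unitarymx.
Proof. by move=> QQ QH; apply/unitarymxP; rewrite QH. Qed.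

(* Block values 3/5 and 4/5, away from 0 and 1, keep the sine of the walk angle
   bounded below. *)
Lemma encode_projector (P : 'M[C]_(2 ^ k)) : (0 < e)%N -> P *m P = P -> P ^t* = P ->
  exists V : 'M[C]_(2 ^ W), [/\ V *m V = 1%:M, V ^t* = V &
    forall psi : 'cV[C]_(2 ^ k), let chi := pstate E psi (delta_mx (zidx e) 0) in
    (chi ^t* *m (V *m chi)) 0 0 =
      (3 / 5 : R)%:C%C * (psi ^t* *m psi) 0 0 + (1 / 5 : R)%:C%C * (psi ^t* *m (P *m psi)) 0 0].
Proof.
move=> e0 PP PH; have e1 : (1 < 2 ^ e)%N by rewrite -{1}(expn0 2) ltn_exp2l.
have [|Q1 [QQ1 QH1 Q1z]] := @reflection_corner R _ (zidx e) (3 / 5) e1; first lra.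
have [|Q2 [QQ2 QH2 Q2z]] := @reflection_corner R _ (zidx e) (4 / 5) e1; first lra.
have PN : P *m (1%:M - P) = 0 by rewrite mulmxBr mulmx1 PP subrr.
have NP : (1%:M - P) *m P = 0 by rewrite mulmxBl mul1mx PP subrr.
(* [Q1] or [Q2] acts according to the outcome of [P]; the cross terms vanish because P (1 - P) = 0,
   so the sum is again a reflection. *)
exists (tens E Q1 (1%:M - P) + tens E Q2 P); split.
- rewrite mulmxDl !mulmxDr !tens_mul PN NP !tens0r addr0 add0r QQ1 QQ2 PP.
  by rewrite mulmxBl mul1mx PN subr0 -tensDr subrK tens1.
- by rewrite linearD /= map_mxD !tens_trC QH1 QH2 PH linearB /= map_mxB PH trmx1 map_mx1.
move=> psi chi; rewrite mulmxDl mulmxDr mxE !tens_pstate !pstate_dot !corner_dot Q1z Q2z.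
have dotB (x y : 'M[C]_1) : (x - y) 0 0 = x 0 0 - y 0 0 by rewrite !mxE.
rewrite mulmxBl mul1mx mulmxBr dotB.
set u := (_ *m psi) 0 0; set v := (_ *m (P *m psi)) 0 0.
rewrite (_ : (4 / 5 : R)%:C%C = (3 / 5 : R)%:C%C + (1 / 5 : R)%:C%C); first by ring.
by rewrite -rmorphD; congr (_%:C%C); field.
Qed.
End ProductStates.

(** * Coins *)

Section Coins.
Context {R : realType}.
Local Notation C := (R[i]).

Definition expect {D} (P rho : 'M[C]_D) : R := complex.Re (\tr (P *m rho)).

(** The upper bound is positivity for the complementary projector together with trace 1. *)
Lemma expectE D (P rho : 'M[C]_D) : density rho -> P *m P = P -> P ^t* = P ->
  \tr (P *m rho) = (expect P rho)%:C%C /\ 0 <= expect P rho <= 1.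
Proof.
move=> [prho trho] PP PH.
have p0 : 0 <= \tr (P *m rho) by exact: tr_proj_ge0.
have : 0 <= \tr ((1%:M - P) *m rho).
  apply: tr_proj_ge0 => //.
    by rewrite mulmxBl mul1mx mulmxBr mulmx1 PP subrr subr0.
  by rewrite linearB /= map_mxB PH trmx1 map_mx1.
rewrite mulmxBl mul1mx linearB /= trho.
have E : \tr (P *m rho) = (expect P rho)%:C%C by rewrite RRe_real // realE p0.
by move: p0; rewrite E -[1]/(1%:C%C) -rmorphB !ler0c subr_ge0 => -> ->.
Qed.

(** The square of T_k((3 + p)/5), which is the probability of reading all zeros after [k] walk
    steps. *)
Definition bias k (p : R) : R := (complex.Re (zof ((3 + p) / 5) ^+ k)) ^+ 2.

Lemma isometry_norm D (U : 'M[C]_D) (psi : 'cV[C]_D) : U ^t* *m U = 1%:M ->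
  ((U *m psi) ^t* *m (U *m psi)) 0 0 = (psi ^t* *m psi) 0 0.
Proof. by move=> UU; rewrite trmx_mul map_mxM mulmxA -(mulmxA (psi ^t*)) UU mulmx1. Qed.

Lemma dot_self D (psi : 'cV[C]_D) : (psi ^t* *m psi) 0 0 = \sum_i `|psi i 0| ^+ 2.
Proof. by rewrite mxE; apply: eq_bigr => i _; rewrite !mxE mulrC -normCK. Qed.

Lemma delta_norm D (z : 'I_D) : ((delta_mx z 0 : 'cV[C]_D) ^t* *m (delta_mx z 0 : 'cV[C]_D)) 0 0 = 1.
Proof.
rewrite dot_self (bigD1 z) //= big1 => [|i iN].
  by rewrite mxE !eqxx normr1 expr1n addr0.
by rewrite mxE (negPf iN) normr0 expr0n.
Qed.

Lemma walk_norm D (B : 'M[C]_D) z k : B *m B = 1%:M -> B ^t* = B ->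
  \sum_i `|iter k (walk B z) (delta_mx z 0) i 0| ^+ 2 = 1.
Proof.
move=> BB BH; rewrite -dot_self; elim: k => [|k IH]; first exact: delta_norm.
by rewrite iterS {1 2}/walk !isometry_norm ?zrefl_trC ?zrefl_sq ?BH.
Qed.

Section OneOracle.
Context {n a e W : nat} (E : W = (e + (n + a))%N) (P : 'M[C]_(2 ^ n)) (V : 'M[C]_(2 ^ W)).
Hypotheses (VV : V *m V = 1%:M) (VH : V ^t* = V) (PP : P *m P = P) (PH : P ^t* = P).
Hypothesis Vcorner : forall psi : 'cV[C]_(2 ^ (n + a)),
  let chi := pstate E psi (delta_mx (zidx e) 0) in
  (chi ^t* *m (V *m chi)) 0 0 = (3 / 5 : R)%:C%C * (psi ^t* *m psi) 0 0
     + (1 / 5 : R)%:C%C * (psi ^t* *m (liftsys P *m psi)) 0 0.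

Definition query_refl (O : 'M[C]_(2 ^ (n + a))) : 'M[C]_(2 ^ W) :=
  embed W (O ^t*) *m (V *m embed W O).

(** Conjugating [V] by the oracle gives a reflection with corner 3/5 + p/5, so the amplitude at zero
    is a Chebyshev value; the walk preserves the norm, which gives the other outcome the remaining
    mass. *)
Lemma query_refl_law (O : 'M[C]_(2 ^ (n + a))) rho k (b : bool) :
  density rho -> prepares_purification O rho ->
  \sum_(o | (o == zidx W) == b) `|iter k (walk (query_refl O) (zidx W)) (delta_mx (zidx W) 0) o 0| ^+ 2
    = (if b then bias k (expect P rho) else 1 - bias k (expect P rho))%:C%C.
Proof.
move=> drho purO; have [uO _] := purO.
have OO : O *m O ^t* = 1%:M by exact/unitarymxP.
have OO' : O ^t* *m O = 1%:M by move: uO; rewrite /unitary -trmxC_unitary => /unitarymxP; rewrite trmxCK.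
set B := query_refl O.
have emb1 : embed W (1%:M : 'M[C]_(2 ^ (n + a))) = 1%:M by rewrite (embedE E) tens1.
have BB : B *m B = 1%:M.
  rewrite /B /query_refl -!mulmxA (mulmxA (embed W O)) -(embed_mul E) OO emb1 mul1mx.
  by rewrite (mulmxA V V) VV mul1mx -(embed_mul E) OO' emb1.
have BH : B ^t* = B.
  by rewrite /B /query_refl !(trmx_mul, map_mxM) VH !(embed_trC E) trmxCK mulmxA.
have [pE p1] := expectE drho PP PH.
set p := expect P rho in pE p1 *.
have Bz : B (zidx W) (zidx W) = ((3 + p) / 5)%:C%C.
  pose chi := embed W O *m (delta_mx (zidx W) 0 : 'cV[C]_(2 ^ W)).
  have -> : B (zidx W) (zidx W) = (chi ^t* *m (V *m chi)) 0 0.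
    by rewrite -(corner_dot B) /chi trmx_mul map_mxM (embed_trC E) /B /query_refl !mulmxA.
  rewrite /chi -(pstate_zero E) embed_pstate Vcorner.
  rewrite (liftsys_expectation P purO) pE isometry_norm // delta_norm mulr1.
  by rewrite -rmorphM -rmorphD; congr (_%:C%C); field.
have x1 : -1 <= (3 + p) / 5 <= 1 by lra.
have true_law : `|iter k (walk B (zidx W)) (delta_mx (zidx W) 0) (zidx W) 0| ^+ 2 =
    (bias k p)%:C%C.
  rewrite (walk_amplitude BB k x1 Bz) /bias normCK.
  set r := complex.Re _; rewrite (_ : (r%:C%C)^* = r%:C%C) -?rmorphM -?expr2 //.
  by apply/CrealP/complex_realP; exists r.
have := walk_norm (zidx W) k BB BH; rewrite (bigD1 (zidx W)) //= true_law => S.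
case: b; first by rewrite -true_law (big_pred1 (zidx W)) // => i; rewrite /= eqb_id.
rewrite rmorphB rmorph1 -S addrAC subrr add0r; apply: eq_bigl => i.
by rewrite eqbF_neg.
Qed.
End OneOracle.

(** Each block is one walk step, applying S, O, V, O^* in this order, at a cost of two queries. *)
Definition coin_steps W (V : 'M[C]_(2 ^ W)) which k : seq (@step R W) :=
  flatten (nseq k [:: UStep W (zrefl (zidx W)); QStep W which false false;
                      UStep W V; QStep W which true false]).

Lemma coin_steps_unitary W (V : 'M[C]_(2 ^ W)) which k :
  V *m V = 1%:M -> V ^t* = V -> all unitary_step (coin_steps V which k).
Proof.
move=> VV VH; elim: k => //= k ->; rewrite !unitary_refl //.
  exact: zrefl_sq.
exact: zrefl_trC.
Qed.

Lemma coin_steps_count W (V : 'M[C]_(2 ^ W)) which k :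
  count is_query (coin_steps V which k) = (2 * k)%N.
Proof. by elim: k => //= k ->; lia. Qed.

Lemma run_coin_steps ka ks W (V : 'M[C]_(2 ^ W)) which k
  (Oa : 'M[C]_(2 ^ ka)) (Os : 'M[C]_(2 ^ ks)) U U' psi :
  step_mx Oa Os (QStep W which false false) = U ->
  step_mx Oa Os (QStep W which true false) = U' ->
  run Oa Os (coin_steps V which k) psi = iter k (walk (U' *m (V *m U)) (zidx W)) psi.
Proof.
move=> HU HU'; elim: k psi => // k IH psi; rewrite iterSr -IH /= /run /=.
by move: HU HU'; rewrite /= => -> ->; rewrite /walk !mulmxA.
Qed.

(** The law [D] is fixed before the oracles and states: the circuit depends only on the projector,
    on [k], on the register sizes and on which oracle is queried. *)
Lemma coin_realizable n ar as_ which (P : 'M[C]_(2 ^ n)) k :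
  P *m P = P -> P ^t* = P ->
  exists D, @realizes R (n + ar) (n + as_) (2 * k) bool D /\
    forall Oa Os rho sigma, density rho -> density sigma ->
      prepares_purification Oa rho -> prepares_purification Os sigma -> forall b,
      D Oa Os b = (let q := bias k (expect P (if which then rho else sigma)) in
                   if b then q else 1 - q)%:C%C.
Proof.
(* The extra qubit ensures that either oracle leaves a nonempty register for the block encoding. *)
move=> PP PH; pose W := ((n + ar) + (n + as_)).+1.
have lift_idem a : @liftsys R n a P *m liftsys P = liftsys P by rewrite liftsys_mul PP.
have lift_herm a : (@liftsys R n a P) ^t* = liftsys P by rewrite liftsys_trC PH.
have Wa : (n + ar < W)%N by rewrite /W ltnS leq_addr.
have Ws : (n + as_ < W)%N by rewrite /W ltnS leq_addl.
pose law V Oa Os b : C := \sum_(o | (o == zidx W) == b)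
  `|@run R (n + ar) (n + as_) W Oa Os (coin_steps V which k) (delta_mx (zidx W) 0) o 0| ^+ 2.
have real V : V *m V = 1%:M -> V ^t* = V -> @realizes R (n + ar) (n + as_) (2 * k) bool (law V).
  move=> VV VH; exists W, (coin_steps V which k), (fun o => o == zidx W).
  by split=> //; [exact: coin_steps_unitary | exact: coin_steps_count].
case: which @law real => law real.
  have E : W = ((n + as_).+1 + (n + ar))%N by rewrite addSn addnC.
  have [|V [VV VH HV]] := encode_projector E _ (lift_idem ar) (lift_herm ar); first by [].
  exists (law V); split; first exact: real.
  move=> Oa Os rho sigma drho _ purO _ b.
  by rewrite -(query_refl_law VV VH PP PH HV k b drho purO) /law (@run_coin_steps _ _ _ _ _ _ _ _ (embed W Oa) (embed W (Oa ^t*))).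
have E : W = ((n + ar).+1 + (n + as_))%N by [].
have [|V [VV VH HV]] := encode_projector E _ (lift_idem as_) (lift_herm as_); first by [].
exists (law V); split; first exact: real.
move=> Oa Os rho sigma _ dsig _ purO b.
by rewrite -(query_refl_law VV VH PP PH HV k b dsig purO) /law (@run_coin_steps _ _ _ _ _ _ _ _ (embed W Os) (embed W (Os ^t*))).
Qed.
End Coins.

(** * Phase resolution *)

Section PhaseResolution.
Context {R : realType}.
Local Notation C := (R[i]).
Local Notation N := (@ComplexField.Normc.normc R).
Local Notation Re := (@complex.Re R).
Local Notation Im := (@complex.Im R).

Lemma normc_ge0 (w : C) : 0 <= N w.
Proof. by case: w => a b; rewrite sqrtr_ge0. Qed.

Lemma abs_Re_le_normc (w : C) : `|Re w| <= N w.
Proof. by case: w => a b /=; rewrite -sqrtr_sqr ler_wsqrtr // lerDl sqr_ge0. Qed.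

Lemma normc_le_abs (w : C) : N w <= `|Re w| + `|Im w|.
Proof.
case: w => a b /=; rewrite -[leRHS]ger0_norm ?addr_ge0 ?normr_ge0 // -sqrtr_sqr.
rewrite ler_wsqrtr // sqrrD !real_normK ?num_real // addrAC lerDl mulrn_wge0 //.
by rewrite mulr_ge0.
Qed.

Lemma normcX (w : C) k : N (w ^+ k) = N w ^+ k.
Proof.
elim: k => [|k IH]; first by rewrite !expr0 ComplexField.Normc.normc1.
by rewrite !exprS ComplexField.Normc.normcM IH.
Qed.

Lemma unit_circle (w : C) : N w = 1 -> Re w ^+ 2 + Im w ^+ 2 = 1.
Proof.
case: w => a b /= /(congr1 (fun u => u ^+ 2)).
by rewrite sqr_sqrtr ?expr1n // addr_ge0 ?sqr_ge0.
Qed.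

Lemma bernoulli_ineq (t : R) m : 0 <= t <= 1 -> 1 - m%:R * t <= (1 - t) ^+ m.
Proof.
move=> /andP [t0 t1]; elim: m => [|m IH]; first by rewrite mul0r subr0 expr0.
rewrite exprS; apply: (@le_trans _ _ ((1 - t) * (1 - m%:R * t))).
  rewrite -natr1; have : 0 <= (m%:R : R) by rewrite ler0n.
  by move=> m0; nra.
by rewrite ler_wpM2l // subr_ge0.
Qed.

(** On the unit circle |u + v| >= 2 - |u - v|, so while two points stay e-close, squaring expands
    their distance by a factor at least 2 - e. After m squarings the distance is still at most e. *)
Lemma doubling_contracts (y y' : C) (e : R) m : N y = 1 -> N y' = 1 -> 0 <= e <= 2 ->
  (forall j, (j <= m)%N -> N (y ^+ (2 ^ j) - y' ^+ (2 ^ j)) <= e) ->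
  N (y - y') * (2 - e) ^+ m <= e.
Proof.
move=> y1 y1' e2 H.
suff: forall j, (j <= m)%N ->
    N (y - y') * (2 - e) ^+ j <= N (y ^+ (2 ^ j) - y' ^+ (2 ^ j)).
  by move=> /(_ _ (leqnn m)) K; apply: le_trans K (H _ _).
elim=> [|j IH] jm; first by rewrite expr0 mulr1 expn0 !expr1.
rewrite exprSr mulrA expnSr !exprM subr_sqr ComplexField.Normc.normcM.
apply: ler_pM; rewrite ?subr_ge0 ?mulr_ge0 ?normc_ge0 ?exprn_ge0 ?subr_ge0 //; try lra.
  exact/IH/ltnW.
have := H j (ltnW jm); set u := _ ^+ _; set v := _ ^+ _ => uv.
have uE : u * 2 = (u + v) + (u - v) by ring.
have := @le_normcD _ (u + v) (u - v); rewrite -uE ComplexField.Normc.normcM.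
have -> : N 2 = 2.
  by rewrite /= addr0 expr0n addr0 sqrtr_sqr ger0_norm // addr_ge0.
by rewrite /u normcX y1 expr1n -/u; lra.
Qed.

(** The unit number of angle 2 theta with cos theta = (3 + p)/5; coins expose its powers because
    cos^2 is half of 1 plus the cosine of the double angle. *)
Definition phase (p : R) : C := zof ((3 + p) / 5) ^+ 2.

Section Phase.
Variable (p : R).
Hypothesis p01 : 0 <= p <= 1.

Lemma sin_sq_ge0 : 0 <= 1 - ((3 + p) / 5) ^+ 2.
Proof.
have x1 : 3 / 5 <= (3 + p) / 5 <= 4 / 5 by have [? ?] := andP p01; apply/andP; split; lra.
by move: ((3 + p) / 5) x1 => x /andP [x3 x4]; nra.
Qed.

Lemma zof_norm : N (zof ((3 + p) / 5)) = 1.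
Proof. by rewrite /= sqr_sqrtr ?sin_sq_ge0 // subrKC sqrtr1. Qed.

Lemma phase_norm : N (phase p) = 1.
Proof. by rewrite normcX zof_norm expr1n. Qed.

Lemma bias_phase k : bias k p = (1 + Re (phase p ^+ k)) / 2.
Proof.
rewrite /bias /phase -exprM mulnC exprM.
have : N (zof ((3 + p) / 5) ^+ k) = 1 by rewrite normcX zof_norm expr1n.
move: (_ ^+ k) => w /unit_circle; rewrite (expr2 w); case: w => a b /= u.
by rewrite -!expr2; lra.
Qed.

Lemma Re_phase : Re (phase p) = 2 * ((3 + p) / 5) ^+ 2 - 1.
Proof. by rewrite /phase expr2 /= -!expr2 sqr_sqrtr ?sin_sq_ge0 //; ring. Qed.

(** As x = (3 + p)/5 lies in [3/5, 4/5], the real part 2x^2 - 1 is at most 7/25 in absolute value,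
    and 7, 24, 25 is a Pythagorean triple. *)
Lemma Im_phase_ge : 24 / 25 <= Im (phase p).
Proof.
have := unit_circle phase_norm; rewrite Re_phase.
have : 0 <= Im (phase p).
  by rewrite /phase expr2 /= addr_ge0 // mulr_ge0 ?sqrtr_ge0 //; have [? ?] := andP p01; lra.
have : 3 / 5 <= (3 + p) / 5 <= 4 / 5 by have [? ?] := andP p01; apply/andP; split; lra.
move: ((3 + p) / 5) (Im _) => x s /andP [x3 x4] s0 U.
have u1 : - (7 / 25) <= 2 * x ^+ 2 - 1 by nra.
have u2 : 2 * x ^+ 2 - 1 <= 7 / 25 by nra.
by move: (2 * _ - 1) u1 u2 U => u u1 u2 U; nra.
Qed.
End Phase.

(* Im y^k is recovered from Re y^k and Re y^(k+1) because Im y is bounded below. *)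
Lemma phase_pow_close (p p' eta : R) k : 0 <= p <= 1 -> 0 <= p' <= 1 ->
  `|Re (phase p) - Re (phase p')| <= eta ->
  `|Re (phase p ^+ k) - Re (phase p' ^+ k)| <= eta ->
  `|Re (phase p ^+ k.+1) - Re (phase p' ^+ k.+1)| <= eta ->
  N (phase p ^+ k - phase p' ^+ k) <= 9 / 2 * eta.
Proof.
move=> p1 p1' Hr Ha Ht; apply: le_trans (normc_le_abs _) _; move: Hr Ha Ht.
have s24 := Im_phase_ge p1; have s24' := Im_phase_ge p1'.
have U := unit_circle (phase_norm p1); have U' := unit_circle (phase_norm p1').
have : Re (phase p ^+ k) ^+ 2 + Im (phase p ^+ k) ^+ 2 = 1.
  by apply: unit_circle; rewrite normcX phase_norm // expr1n.
have : Re (phase p' ^+ k) ^+ 2 + Im (phase p' ^+ k) ^+ 2 = 1.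
  by apply: unit_circle; rewrite normcX phase_norm // expr1n.
rewrite !(exprS _ k); move: (_ ^+ k) (_ ^+ k) => [a b] [a' b'].
move: (phase p) (phase p') U U' s24 s24' => [r s] [r' s'] /= U U' s24 s24' W' W.
move=> Hr Ha Ht.
have abs_le (u c : R) : 0 <= c -> u ^+ 2 <= c ^+ 2 -> `|u| <= c.
  by move=> c0 uc; rewrite -(ger0_norm c0) -ler_sqr ?nnegrE // !real_normK ?num_real.
have r7 : `|r| <= 7 / 25 by apply: abs_le; nra.
have r7' : `|r'| <= 7 / 25 by apply: abs_le; nra.
have a1' : `|a'| <= 1 by apply: abs_le => //; rewrite expr1n; have := sqr_ge0 b'; lra.
have b1' : `|b'| <= 1 by apply: abs_le => //; rewrite expr1n; have := sqr_ge0 a'; lra.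
have mul_le (u v c d : R) : `|u| <= c -> `|v| <= d -> `|u * v| <= c * d.
  by move=> uc vd; rewrite normrM ler_pM.
have eta0 : 0 <= eta by apply: le_trans (normr_ge0 _) Hr.
(* Both points are on the circle, so (s - s')(s + s') = -(r - r')(r + r'), with |r + r'| <= 14/25
   and s + s' >= 48/25. *)
have Hs : `|s - s'| <= 7 / 24 * eta.
  have : `|(s - s') * (s + s')| <= eta * (14 / 25).
    have -> : (s - s') * (s + s') = - ((r - r') * (r + r')) by rewrite -!subr_sqr; lra.
    by rewrite normrN; apply: mul_le => //; apply: le_trans (ler_normD _ _) _; lra.
  rewrite normrM (ger0_norm (_ : 0 <= s + s')); last lra.
  by have := normr_ge0 (s - s'); nra.
(* By angle addition Re y^(k+1) = r a - s b; solving for s (b - b') leaves four errors totalling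
   less than 3 eta. Division by s >= 24/25 and the error of the real part then stay within 9/2
   eta. *)
have Hb : `|(b - b') * s| <= 3 * eta.
  have -> : (b - b') * s = r * (a - a') + a' * (r - r')
      - ((r * a - s * b) - (r' * a' - s' * b')) - b' * (s - s') by ring.
  have := mul_le _ _ _ _ r7 Ha; have := mul_le _ _ _ _ a1' Hr.
  have := mul_le _ _ _ _ b1' Hs; move: Ht.
  move: (r * _) (a' * _) (_ - _ - (_ - _)) (b' * _) => A1 A2 A3 A4.
  by rewrite !ler_norml => ? ? ? ?; apply/andP; split; lra.
move: Hb; rewrite normrM (ger0_norm (_ : 0 <= s)); last lra.
by have := normr_ge0 (b - b'); nra.
Qed.

(** Precision 1/m over m doublings costs only a constant, as (2 - 1/m)^m >= 2^m / 2 by Bernoulli.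
    The real part of the phase varies with p at rate at least 12/25, and 25/6 <= 5. *)
Lemma phase_resolution m (p p' : R) : (0 < m)%N -> 0 <= p <= 1 -> 0 <= p' <= 1 ->
  (forall (j : nat) (b : bool), (j <= m)%N ->
     `|Re (phase p ^+ (2 ^ j + b)) - Re (phase p' ^+ (2 ^ j + b))| <= 2 / (9 * m%:R)) ->
  `|p - p'| <= 5 / 2 ^+ m.
Proof.
move=> m0 p1 p1' H; have mR : 1 <= (m%:R : R) by rewrite ler1n.
pose e : R := m%:R^-1.
have e0 : 0 < e by rewrite invr_gt0; lra.
have e1 : e <= 1 by rewrite invf_le1 //; lra.
have close j : (j <= m)%N -> N (phase p ^+ (2 ^ j) - phase p' ^+ (2 ^ j)) <= e.
  move=> jm; have -> : e = 9 / 2 * (2 / (9 * m%:R)) by rewrite /e; field; lra.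
  apply: phase_pow_close => //.
  (* The exponent 2^0 + 0 = 1 supplies the cosine of the phase itself. *)
  - by have := H 0%N false (leq0n _); rewrite expn0 addn0 !expr1.
  - by have := H j false jm; rewrite addn0.
  - by have := H j true jm; rewrite addn1.
have := doubling_contracts (phase_norm p1) (phase_norm p1') _ close.
move=> /(_ ltac:(lra)) D.
have B : 2 ^+ m / 2 <= (2 - e) ^+ m.
  have -> : 2 - e = 2 * (1 - e / 2) by field.
  rewrite exprMn ler_wpM2l ?exprn_ge0 //.
  apply: le_trans (_ : 1 - m%:R * (e / 2) <= _); last by apply: bernoulli_ineq; lra.
  by rewrite /e mulrA divff; lra.
have M0 : 0 < (2 : R) ^+ m by rewrite exprn_gt0.
rewrite ler_pdivlMr //.
have nD := normc_ge0 (phase p - phase p').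
have D2 : N (phase p - phase p') * (2 ^+ m / 2) <= 1.
  by apply: le_trans (le_trans D e1); rewrite ler_wpM2l.
have K : 12 / 25 * `|p - p'| <= N (phase p - phase p').
  apply: le_trans (abs_Re_le_normc _).
  have -> : Re (phase p - phase p') = Re (phase p) - Re (phase p').
    by case: (phase p) => ? ?; case: (phase p').
  rewrite !Re_phase //.
  have -> : 2 * ((3 + p) / 5) ^+ 2 - 1 - (2 * ((3 + p') / 5) ^+ 2 - 1) =
     (p - p') * (2 / 25 * (6 + p + p')) by field.
  rewrite normrM mulrC ler_wpM2l //; apply: le_trans (ler_norm _); lra.
have : 12 / 25 * `|p - p'| * (2 ^+ m / 2) <= 1.
  by apply: le_trans D2; rewrite ler_wpM2r //; lra.
have := normr_ge0 (p - p'); move: (`|_|) (2 ^+ m) M0 => u v; nra.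
Qed.
End PhaseResolution.

(** * Concentration *)

Section Hoeffding.
Context {R : realType} {I : finType}.
Variable beta : I -> R.
Hypothesis beta01 : forall i, 0 <= beta i <= 1.

Definition coin_law (x : {ffun I -> bool}) : R :=
  \prod_i (if x i then beta i else 1 - beta i).

Lemma coin_law_ge0 x : 0 <= coin_law x.
Proof.
by apply: prodr_ge0 => i _; have /andP [b0 b1] := beta01 i; case: ifP; rewrite ?subr_ge0.
Qed.

Lemma coin_law_expectation (f : I -> bool -> R) :
  \sum_(x : {ffun I -> bool}) coin_law x * \prod_i f i (x i) =
    \prod_i (beta i * f i true + (1 - beta i) * f i false).
Proof.
transitivity (\sum_(x : {ffun I -> bool})
    \prod_i ((if x i then beta i else 1 - beta i) * f i (x i))).
  by apply: eq_bigr => x _; rewrite big_split.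
rewrite -(bigA_distr_bigA (fun i b => (if b then beta i else 1 - beta i) * f i b)).
by apply: eq_bigr => i _; rewrite big_bool.
Qed.

Lemma coin_law_total : \sum_x coin_law x = 1.
Proof.
have := coin_law_expectation (fun _ _ => 1).
rewrite [X in _ = X]big1 => [<-|i _]; last by ring.
by apply: eq_bigr => x _; rewrite big1_eq mulr1.
Qed.

(** Invert e^(-u) >= 1 - u and use (1 - u)(1 + u + 2u^2) = 1 + u^2 (1 - 2u) >= 1. *)
Lemma expR_le_quadratic (u : R) : -1 <= u <= 1 / 2 -> expR u <= 1 + u + 2 * u ^+ 2.
Proof.
move=> /andP [u0 u1]; have := expR_ge1Dx (- u); rewrite expRN.
have := expR_gt0 u; move: (expR u) => E E0 H.
have := ler_pM2l E0 (1 - u) E^-1; rewrite divff ?gt_eqF // H => K.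
have : (1 - u) * (1 + u + 2 * u ^+ 2) >= 1 by rewrite expr2; nra.
by nra.
Qed.

(** The linear terms cancel because the coin is centred; the quadratic ones carry the factor b (1 -
    b) <= 1. *)
Lemma coin_mgf (b t : R) : 0 <= b <= 1 -> - (1 / 2) <= t <= 1 / 2 ->
  b * expR (t * (1 - b)) + (1 - b) * expR (t * (0 - b)) <= expR (2 * t ^+ 2).
Proof.
move=> /andP [b0 b1] /andP [t0 t1].
apply: le_trans (_ : 1 + 2 * t ^+ 2 <= _); last exact: expR_ge1Dx.
have A : b * expR (t * (1 - b)) <= b * (1 + t * (1 - b) + 2 * (t * (1 - b)) ^+ 2).
  by apply: ler_wpM2l => //; apply: expR_le_quadratic; apply/andP; split; nra.
have B : (1 - b) * expR (t * (0 - b)) <= (1 - b) * (1 + t * (0 - b) + 2 * (t * (0 - b)) ^+ 2).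
  by apply: ler_wpM2l; [lra|apply: expR_le_quadratic; apply/andP; split; nra].
apply: le_trans (lerD A B) _.
have -> : b * (1 + t * (1 - b) + 2 * (t * (1 - b)) ^+ 2) +
   (1 - b) * (1 + t * (0 - b) + 2 * (t * (0 - b)) ^+ 2) = 1 + 2 * t ^+ 2 * (b * (1 - b)) by ring.
by rewrite lerD2l ler_piMr //; [rewrite mulr_ge0 ?sqr_ge0|nra].
Qed.

(** Chernoff's argument: the indicator is at most e^(tS - h), whose mean factors over the coins. The
    sign of [t] selects the tail. *)
Lemma one_sided_tail (A : {set I}) (h t : R) : - (1 / 2) <= t <= 1 / 2 ->
  \sum_(x : {ffun I -> bool} | h <= t * \sum_(i in A) ((x i)%:R - beta i)) coin_law x <=
    expR (#|A|%:R * (2 * t ^+ 2) - h).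
Proof.
move=> t1; rewrite big_mkcond /=.
pose f i (b : bool) : R := if i \in A then expR (t * (b%:R - beta i)) else 1.
apply: le_trans (_ : \sum_(x : {ffun I -> bool}) coin_law x * \prod_i f i (x i) * expR (- h) <= _).
  apply: ler_sum => x _; rewrite -mulrA.
  have -> : \prod_i f i (x i) = expR (t * \sum_(i in A) ((x i)%:R - beta i)).
    by rewrite /f -big_mkcond /= big_distrr /= expR_sum.
  rewrite -expRD; case: ifP => [H|_]; last by rewrite mulr_ge0 ?coin_law_ge0 ?expR_ge0.
  rewrite ler_peMr ?coin_law_ge0 //; apply: le_trans (expR_ge1Dx _).
  by rewrite lerDl subr_ge0.
rewrite -big_distrl /= coin_law_expectation expRD ler_wpM2r ?expR_ge0 //.
rewrite expRM_natl -prodr_const [leRHS]big_mkcond /=.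
apply: ler_prod => i _; have b1 := beta01 i; have /andP [b0 b2] := b1; rewrite /f.
case: ifP => _; last by rewrite !mulr1 subrKC ler01 lexx.
apply/andP; split; last exact: coin_mgf.
by rewrite addr_ge0 // mulr_ge0 ?expR_ge0 // subr_ge0.
Qed.

Lemma hoeffding (A : {set I}) (h : R) : 0 <= h <= 1 ->
  \sum_(x : {ffun I -> bool} | h * #|A|%:R < `|\sum_(i in A) ((x i)%:R - beta i)|) coin_law x <=
    2 * expR (- (#|A|%:R * (h ^+ 2 / 8))).
Proof.
move=> /andP [h0 h1]; pose S (x : {ffun I -> bool}) := \sum_(i in A) ((x i)%:R - beta i).
have tail (s : R) : s = 1 \/ s = -1 ->
    \sum_(x : {ffun I -> bool} | h / 4 * (h * #|A|%:R) <= s * (h / 4) * S x) coin_law x <=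
      expR (- (#|A|%:R * (h ^+ 2 / 8))).
  (* The choice |t| = h/4 minimises 2t^2 - h |t|, with value -h^2/8. *)
  move=> s1; have -> : - (#|A|%:R * (h ^+ 2 / 8)) =
      #|A|%:R * (2 * (s * (h / 4)) ^+ 2) - h / 4 * (h * #|A|%:R).
    by rewrite exprMn (_ : s ^+ 2 = 1); [field|case: s1 => ->; ring].
  by apply: one_sided_tail; case: s1 => ->; apply/andP; split; lra.
rewrite mulr_natl mulr2n.
apply: le_trans (lerD (tail 1 (or_introl erefl)) (tail (-1) (or_intror erefl))).
pose F (s : R) x := if h / 4 * (h * #|A|%:R) <= s * (h / 4) * S x then coin_law x else 0.
rewrite [X in _ <= X](_ : _ = \sum_x (F 1 x + F (-1) x)); last first.
  by rewrite big_split /= /F -!big_mkcond.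
rewrite big_mkcond /=; apply: ler_sum => x _; rewrite /F -/(S x).
have L := coin_law_ge0 x.
case: ifP => [H|_]; last by apply: addr_ge0; case: ifP.
have h4 : 0 <= h / 4 by lra.
have [Sx|Sx] := lerP 0 (S x).
  rewrite ifT; first by rewrite lerDl; case: ifP.
  by rewrite mul1r ler_wpM2l // ltW //; move: H; rewrite ger0_norm.
rewrite addrC ifT; first by rewrite lerDl; case: ifP.
by rewrite mulN1r mulNr -mulrN ler_wpM2l // ltW //; move: H; rewrite ltr0_norm.
Qed.
End Hoeffding.

(** * Matrix square roots *)

Section Fidelity.
Context {R : realType} {D : nat}.
Local Notation C := (R[i]).
Implicit Types (A B K P Q X Y U : 'M[C]_D).

Definition fnorm (X : 'M[C]_D) : C := sqrtC (\tr (X *m X ^t*)).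

Lemma trC_mul X Y : (X *m Y) ^t* = Y ^t* *m X ^t*.
Proof. by rewrite trmx_mul map_mxM. Qed.

Lemma tr_dotE X Y : \tr (X *m Y ^t*) = \sum_i \sum_j X i j * (Y i j)^*.
Proof. by apply: eq_bigr => i _; rewrite mxE; apply: eq_bigr => j _; rewrite !mxE. Qed.

Lemma tr_sqE X : \tr (X *m X ^t*) = \sum_i \sum_j `|X i j| ^+ 2.
Proof.
by rewrite tr_dotE; apply: eq_bigr => i _; apply: eq_bigr => j _; rewrite normCK.
Qed.

Lemma tr_sq_ge0 X : 0 <= \tr (X *m X ^t*).
Proof.
by rewrite tr_sqE; apply: sumr_ge0 => i _; apply: sumr_ge0 => j _; rewrite exprn_ge0.
Qed.

Lemma fnorm_ge0 X : 0 <= fnorm X.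
Proof. by rewrite sqrtC_ge0 tr_sq_ge0. Qed.

Lemma tr_cauchy_schwarz X Y : `|\tr (X *m Y ^t*)| <= fnorm X * fnorm Y.
Proof.
have E (Z T : 'M[C]_D) : \tr (Z *m T ^t*) = dotmx (mxvec Z) (mxvec T).
  rewrite tr_dotE dotmxE mxE pair_big /=.
  rewrite [RHS](reindex _ (curry_mxvec_bij _ _)) /=.
  by apply: eq_bigr => -[i j] _; rewrite !mxE !mxvecE.
rewrite /fnorm !E; exact: (CauchySchwarz_sqrt (@dotmx C _) (mxvec X) (mxvec Y)).1.
Qed.

Lemma fnorm_unitaryl U X : U ^t* *m U = 1%:M -> fnorm (U *m X) = fnorm X.
Proof. by move=> UU; rewrite /fnorm trC_mul mxtrace_mulC -!mulmxA (mulmxA _ U) UU mul1mx mxtrace_mulC. Qed.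

Lemma fnorm_le_entries X (d : C) : (forall i j, `|X i j| <= d) -> fnorm X <= D%:R * d.
Proof.
(* In dimension 0 the entry bound does not force [d] to be nonnegative, so this case is separate. *)
move=> Xd; have [D0|D0] := posnP D.
  have -> : fnorm X = 0.
    by rewrite /fnorm tr_sqE big1 ?sqrtC0 // => i; have := ltn_ord i; rewrite {2}D0.
  by rewrite D0 mul0r.
have d0 : 0 <= d by exact: le_trans (normr_ge0 _) (Xd (Ordinal D0) (Ordinal D0)).
rewrite -(@sqrCK _ (D%:R * d)) ?mulr_ge0 ?ler0n // /fnorm ler_sqrtC ?qualifE /= ?tr_sq_ge0 ?exprn_ge0 ?mulr_ge0 ?ler0n //.
rewrite tr_sqE; apply: le_trans (_ : \sum_(i < D) \sum_(j < D) d ^+ 2 <= _).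
  by do 2!apply: ler_sum => ? _; rewrite lerXn2r ?qualifE /= ?normr_ge0 //.
by rewrite !sumr_const !card_ord -mulrnA -[X in X <= _]mulr_natl natrM exprMn (expr2 D%:R).
Qed.

Lemma tr_congr_ge0 X A : psdmx A -> 0 <= \tr (X *m A *m X ^t*).
Proof.
move=> [_ pA]; apply: sumr_ge0 => i _; have := pA (row i X).
by congr (0 <= _); rewrite -row_mul !mxE; apply: eq_bigr => j _; rewrite !mxE.
Qed.

Section UnitaryDiag.
Variables (P : 'M[C]_D) (d : 'rV[C]_D).
Hypothesis uP : P \is unitarymx.
Local Notation PdP d := (P ^t* *m diag_mx d *m P).

Let PP : P *m P ^t* = 1%:M. Proof. exact/unitarymxP. Qed.
Let PP' : P ^t* *m P = 1%:M.
Proof. by move: uP; rewrite -trmxC_unitary => /unitarymxP; rewrite trmxCK. Qed.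

Lemma diag_quadE (v : 'rV[C]_D) :
  (v *m PdP d *m v ^t*) 0 0 = \sum_i d 0 i * `|(v *m P ^t*) 0 i| ^+ 2.
Proof.
have -> : v *m PdP d *m v ^t* = (v *m P ^t*) *m diag_mx d *m (v *m P ^t*) ^t*.
  by rewrite trmx_mul map_mxM trmxCK !mulmxA.
move: (v *m P ^t*) => w; rewrite mul_mx_diag mxE; apply: eq_bigr => i _.
by rewrite !mxE normCK; ring.
Qed.

Lemma diag_psd : (forall i, 0 <= d 0 i) -> psdmx (PdP d).
Proof.
move=> d0; split; last first.
  by move=> v; rewrite diag_quadE; apply: sumr_ge0 => i _; rewrite mulr_ge0 ?exprn_ge0.
rewrite !trmx_mul !map_mxM trmxCK mulmxA; congr (_ *m _ *m _).
apply/matrixP => i j; rewrite !mxE eq_sym; case: eqP => [->|_]; rewrite ?mulr0n ?rmorph0 //.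
by rewrite !mulr1n; apply/CrealP/ger0_real.
Qed.

Lemma diag_shift mu : PdP d - mu%:M = PdP (d - const_mx mu).
Proof.
rewrite linearB /= mulmxBr mulmxBl diag_const_mx; congr (_ - _).
by rewrite -scalemx1 -scalemxAr mulmx1 -scalemxAl PP'.
Qed.

Lemma diag_entry i : (row i P *m PdP d *m (row i P) ^t*) 0 0 = d 0 i.
Proof.
rewrite diag_quadE -row_mul PP (bigD1 i) //= big1 => [|j jN].
  by rewrite !mxE eqxx normr1 expr1n mulr1 addr0.
by rewrite !mxE eq_sym (negPf jN) normr0 expr0n mulr0.
Qed.
End UnitaryDiag.

Lemma psd_spectral A : psdmx A -> exists P d,
  [/\ P \is unitarymx, A = P ^t* *m diag_mx d *m P,
      sqrtm A = P ^t* *m diag_mx (map_mx sqrtC d) *m P & forall i, 0 <= d 0 i].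
Proof.
move=> [AH pA]; exists (spectralmx A), (spectral_diag A).
have uP := spectral_unitarymx A.
have AE : A = (spectralmx A) ^t* *m diag_mx (spectral_diag A) *m spectralmx A.
  rewrite -invmx_unitary //; apply/orthomx_spectralP/normalmxP.
  by rewrite AH.
split; [exact: uP | exact: AE | by rewrite /sqrtm invmx_unitary | move=> i].
rewrite -(diag_entry (spectral_diag A) uP i) -AE; exact: pA.
Qed.

Lemma sqrtm_spec A : psdmx A ->
  [/\ psdmx (sqrtm A), sqrtm A *m sqrtm A = A & (sqrtm A) ^t* = sqrtm A].
Proof.
move=> pA; have [P [d [uP AE -> d0]]] := psd_spectral pA.
have pS : psdmx (P ^t* *m diag_mx (map_mx sqrtC d) *m P).
  by apply: diag_psd => i; rewrite mxE sqrtC_ge0.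
split; [exact: pS | | exact: pS.1].
have uP' := unitarymxP uP; rewrite [RHS]AE.
move: (P ^t*) uP' => P' uP'; rewrite -!mulmxA (mulmxA P P') uP' mul1mx (mulmxA (diag_mx _)).
rewrite mulmx_diag; congr (_ *m (diag_mx _ *m _)).
by apply/matrixP => i j; rewrite !mxE ord1 -expr2 sqrtCK.
Qed.

(** An eigenvalue at least mu is at least mu^2, since mu <= 1, so its root is at least mu. This
    floor, with mu = 1/k, yields the later constant k/2. *)
Lemma sqrtm_lowner A mu : 0 <= mu <= 1 -> psdmx A -> lowner mu%:M A -> lowner mu%:M (sqrtm A).
Proof.
move=> /andP [mu0 mu1] pA [_ lA]; have [P [d [uP AE -> d0]]] := psd_spectral pA.
rewrite /lowner (diag_shift _ uP); apply: diag_psd => i; rewrite !mxE subr_ge0.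
have : mu <= d 0 i.
  by have := lA (row i P); rewrite {1}AE (diag_shift _ uP) (diag_entry _ uP) !mxE subr_ge0.
move=> mud; rewrite -(@sqrCK _ mu) // ler_sqrtC ?qualifE /= ?exprn_ge0 //.
by apply: le_trans mud; rewrite expr2 ler_piMr.
Qed.

(** A kernel vector v satisfies 0 <= -mu |v|^2, hence vanishes. *)
Lemma lowner_unit A mu : 0 < mu -> lowner mu%:M A -> A \in unitmx.
Proof.
move=> mu0 [_ lA]; rewrite -row_free_unit -kermx_eq0; apply/eqP/row_matrixP => i.
have := lA (row i (kermx A)); rewrite row0.
move: (row i _) (sub_kermxP (row_sub i (kermx A))) => v vA.
rewrite mulmxBr vA sub0r mul_mx_scalar mulNmx mxE -scalemxAl mxE oppr_ge0.
rewrite pmulr_rle0 // => v0; apply/matrixP => a b; rewrite mxE ord1.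
move: v0; rewrite mxE; under eq_bigr => j _ do rewrite !mxE -normCK.
move=> v0; have /psumr_eq0P : \sum_j `|v 0 j| ^+ 2 = 0.
  by apply/le_anti; rewrite v0; apply: sumr_ge0 => j _; rewrite exprn_ge0.
move=> /(_ _ b isT) H; apply/eqP; rewrite -normr_eq0 -sqrf_eq0; apply/eqP/H => j _.
by rewrite exprn_ge0.
Qed.

(* Pairing P^2 - Q^2 = P (P - Q) + (P - Q) Q with P - Q bounds it from below. *)
Lemma sqrt_lipschitz P Q mu : 0 < mu -> P ^t* = P -> Q ^t* = Q ->
  lowner mu%:M P -> lowner mu%:M Q ->
  2 * mu * fnorm (P - Q) <= fnorm (P *m P - Q *m Q).
Proof.
move=> mu0 PH QH lP lQ; set X := P - Q; set Z := P *m P - Q *m Q.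
have XH : X ^t* = X by rewrite /X linearB /= map_mxB PH QH.
have ZH : Z ^t* = Z by rewrite /Z linearB /= map_mxB !trC_mul PH QH.
have ZE : Z = P *m X + X *m Q by rewrite /X mulmxBr mulmxBl addrA subrK.
have low (A : 'M[C]_D) : lowner mu%:M A -> mu * fnorm X ^+ 2 <= \tr (X *m A *m X).
  move=> lA; rewrite sqrtCK -subr_ge0; have := tr_congr_ge0 X lA.
  by rewrite mulmxBr mulmxBl XH linearB /= mul_mx_scalar -scalemxAl linearZ.
have K : 2 * mu * fnorm X ^+ 2 <= fnorm X * fnorm Z.
  apply: le_trans (tr_cauchy_schwarz X Z); rewrite ZH ZE mulmxDr linearD /=.
  rewrite mulmxA [\tr (X *m (X *m Q))]mxtrace_mulC.
  have f0 : 0 <= mu * fnorm X ^+ 2 by rewrite mulr_ge0 ?exprn_ge0 ?fnorm_ge0 // ltW.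
  rewrite ger0_norm; last by rewrite addr_ge0 // (le_trans f0) ?low.
  by rewrite -mulrA mulr_natl mulr2n lerD ?low.
have := fnorm_ge0 X; rewrite le_eqVlt => /orP [/eqP <-|X0].
  by rewrite mulr0 fnorm_ge0.
by rewrite -(ler_pM2l X0) mulrCA -expr2.
Qed.
End Fidelity.

(** * Continuity of the fidelity *)

Section FidelityLipschitz.
Context {R : realType} {D : nat}.
Local Notation C := (R[i]).
Implicit Types (A B K P Q X Y U rho sigma : 'M[C]_D).

Lemma density_sqrt_norm rho : density rho -> fnorm (sqrtm rho) = 1.
Proof.
by move=> [prho trho]; have [_ SS SH] := sqrtm_spec prho; rewrite /fnorm SH SS trho sqrtC1.
Qed.

Lemma psd_gram A : psdmx (A ^t* *m A).
Proof.
split; first by rewrite trC_mul trmxCK.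
move=> v; have -> : v *m (A ^t* *m A) *m v ^t* = (v *m A ^t*) *m (v *m A ^t*) ^t*.
  by rewrite trmx_mul map_mxM trmxCK !mulmxA.
by rewrite mxE; apply: sumr_ge0 => i _; rewrite !mxE mul_conjC_ge0.
Qed.

(** * Polar decomposition and the fidelity as a maximum over unitaries *)

Section Polar.
Variables (rho sigma : 'M[C]_D) (mu nu : C).
Hypotheses (prho : psdmx rho) (psig : psdmx sigma) (mu0 : 0 < mu <= 1) (nu0 : 0 < nu <= 1).
Hypotheses (lrho : lowner mu%:M rho) (lsig : lowner nu%:M sigma).

Let A := sqrtm rho *m sqrtm sigma.
Let K := sqrtm (sqrtm sigma *m rho *m sqrtm sigma).

Lemma gramE : A ^t* *m A = sqrtm sigma *m rho *m sqrtm sigma.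
Proof.
have [_ rr rH] := sqrtm_spec prho; have [_ _ sH] := sqrtm_spec psig.
rewrite /A; move: (sqrtm rho) (sqrtm sigma) rH rr sH => a b aH <- bH.
by rewrite trC_mul aH bH !mulmxA.
Qed.

Lemma fidelity_psd : psdmx K /\ K *m K = A ^t* *m A.
Proof.
have := sqrtm_spec (psd_gram A); rewrite gramE => -[pK KK _].
by split; [exact: pK | exact: KK].
Qed.

Lemma fidelity_ge0 : 0 <= fidelity rho sigma.
Proof.
have [pK _] := fidelity_psd; rewrite /fidelity -/K.
by have := tr_congr_ge0 1%:M pK; rewrite trmx1 map_mx1 mul1mx mulmx1.
Qed.

(** The lower bounds on the states make K invertible, so the unitary factor is A K^(-1). *)
Lemma polar : exists U, [/\ U ^t* *m U = 1%:M, U *m U ^t* = 1%:M & A = U *m K].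
Proof.
have [[KH _] KK] := fidelity_psd.
have Ku : K \in unitmx.
  have unit_sqrt (S : 'M[C]_D) (la : C) : psdmx S -> 0 < la <= 1 -> lowner la%:M S -> sqrtm S \in unitmx.
    move=> pS /andP [la0 la1] lS; apply: (lowner_unit la0); apply: sqrtm_lowner => //.
    by rewrite ltW.
  have : K *m K \in unitmx.
    have us := unit_sqrt _ _ psig nu0 lsig; have /andP [m0 _] := mu0.
    rewrite KK gramE; move: (sqrtm sigma) us => b ub.
    by rewrite !unitmx_mul ub (lowner_unit m0 lrho).
  by move: (K) => b; rewrite unitmx_mul => /andP [].
have invH : (invmx K) ^t* = invmx K.
  have := congr1 (fun X : 'M[C]_D => X ^t*) (mulVmx Ku).
  rewrite trC_mul trmx1 map_mx1 KH => /(congr1 (mulmx (invmx K))).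
  by rewrite mulmxA mulVmx // mul1mx mulmx1.
have UU : (A *m invmx K) ^t* *m (A *m invmx K) = 1%:M.
  move: (A) (K) KK Ku invH => A0 K0 KK0 Ku0 invH0.
  by rewrite trC_mul invH0 -mulmxA (mulmxA (A0 ^t*)) -KK0 -mulmxA mulmxV // mulmx1 mulVmx.
exists (A *m invmx K); split; [exact: UU | exact: mulmx1C | by rewrite mulmxKV].
Qed.

(** Split K as L^2 with L self-adjoint; Cauchy-Schwarz bounds the trace of (U V L) L by |L|_2^2 = Tr
    K. *)
Lemma trace_le_fidelity U : U *m U ^t* = 1%:M -> `|\tr (U *m A)| <= fidelity rho sigma.
Proof.
move=> UU; have [pK _] := fidelity_psd; have [V [VV _ AE]] := polar.
have [_ LL LH] := sqrtm_spec pK; set L := sqrtm K in LL LH.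
have UU' : U ^t* *m U = 1%:M by exact: mulmx1C.
have -> : \tr (U *m A) = \tr ((U *m V *m L) *m L ^t*).
  by rewrite AE -LL LH !mulmxA.
have -> : fidelity rho sigma = fnorm (U *m V *m L) * fnorm L.
  rewrite fnorm_unitaryl; last by rewrite trC_mul -mulmxA (mulmxA (U ^t*)) UU' mul1mx.
  by rewrite -expr2 /fnorm sqrtCK LH LL.
exact: tr_cauchy_schwarz.
Qed.

(** The polar factor attains the preceding bound. *)
Lemma fidelity_dual : exists U, U ^t* *m U = 1%:M /\ fidelity rho sigma = \tr (U ^t* *m A).
Proof.
by have [U [UU _ AE]] := polar; exists U; split; [exact: UU|rewrite AE mulmxA UU mul1mx].
Qed.
End Polar.

Lemma mulmx_diff_split (V A A' B B' : 'M[C]_D) :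
  V *m (A *m B) = V *m (A - A') *m B + V *m A' *m (B - B') + V *m (A' *m B').
Proof. by rewrite !mulmxBr !mulmxBl -!mulmxA addrA subrK subrK. Qed.

Lemma tr_cauchy_schwarz_herm X Y : Y ^t* = Y -> `|\tr (X *m Y)| <= fnorm X * fnorm Y.
Proof. by move=> YH; rewrite -{1}YH tr_cauchy_schwarz. Qed.

Lemma trace_product_diff (V A A' B B' : 'M[C]_D) : V ^t* *m V = 1%:M ->
  B ^t* = B -> B' ^t* = B' -> fnorm B = 1 -> fnorm A' = 1 ->
  `|\tr (V *m (A *m B))| <=
    fnorm (A - A') + fnorm (B - B') + `|\tr (V *m (A' *m B'))|.
Proof.
move=> VV BH BH' nB nA'; rewrite (mulmx_diff_split V A A' B B').
have trD X Y : \tr (X + Y) = \tr X + \tr Y by rewrite linearD.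
rewrite 2!trD.
apply: le_trans (ler_normD _ _) _; apply: lerD => //.
apply: le_trans (ler_normD _ _) _; apply: lerD.
  apply: le_trans (tr_cauchy_schwarz_herm (V *m (A - A')) BH) _.
  by rewrite fnorm_unitaryl // nB mulr1.
have BBH : (B - B') ^t* = B - B' by rewrite linearB /= map_mxB BH BH'.
apply: le_trans (tr_cauchy_schwarz_herm (V *m A') BBH) _.
by rewrite fnorm_unitaryl // nA' mul1r.
Qed.

(** The optimal unitary of the first pair is a competitor for the second. Telescoping the product of
    roots leaves two differences, each paired by Cauchy-Schwarz with a factor of norm 1. *)
Lemma fidelity_diff_le rho rho' sigma sigma' (mu nu : C) : 0 < mu <= 1 -> 0 < nu <= 1 ->
  density rho -> density rho' -> density sigma -> density sigma' ->
  lowner mu%:M rho -> lowner mu%:M rho' -> lowner nu%:M sigma -> lowner nu%:M sigma' ->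
  fidelity rho sigma - fidelity rho' sigma' <=
    fnorm (sqrtm rho - sqrtm rho') + fnorm (sqrtm sigma - sqrtm sigma').
Proof.
move=> mu1 nu1 dr dr' ds ds' lr lr' ls ls'.
have [U [UU FE]] := fidelity_dual dr.1 ds.1 mu1 nu1 lr ls.
have UU' : U *m U ^t* = 1%:M by exact: mulmx1C.
have [_ _ sH] := sqrtm_spec ds.1; have [_ _ sH'] := sqrtm_spec ds'.1.
have UC : (U ^t*) ^t* = U by exact: trmxCK.
have F0 := fidelity_ge0 dr.1 ds.1; rewrite lerBlDr -(ger0_norm F0) FE.
have VV : (U ^t*) ^t* *m U ^t* = 1%:M by rewrite UC.
have H := trace_product_diff (sqrtm rho) VV sH sH' (density_sqrt_norm ds) (density_sqrt_norm dr').
apply: le_trans H _; rewrite lerD2l.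
by apply: (trace_le_fidelity dr'.1 ds'.1 mu1 nu1 lr' ls'); rewrite UC.
Qed.

Lemma sqrtm_entries_le rho rho' (k d : R) : 1 <= k -> density rho -> density rho' ->
  lowner ((k^-1)%:C)%C%:M rho -> lowner ((k^-1)%:C)%C%:M rho' ->
  (forall i j, `|rho i j - rho' i j| <= d%:C%C) ->
  fnorm (sqrtm rho - sqrtm rho') <= (k / 2 * (D%:R * d))%:C%C.
Proof.
move=> k1 dr dr' lr lr' H; set mu : C := (k^-1)%:C%C in lr lr' *.
have k0 : 0 < k by apply: lt_le_trans k1.
have mu0 : 0 < mu by rewrite /mu (ltcR 0) invr_gt0.
have mu1 : mu <= 1 by rewrite /mu (lecR _ 1) invf_le1.
have [_ SS SH] := sqrtm_spec dr.1; have [_ SS' SH'] := sqrtm_spec dr'.1.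
have mu01 : 0 <= mu <= 1 by rewrite mu1 ltW.
have ls := sqrtm_lowner mu01 dr.1 lr; have ls' := sqrtm_lowner mu01 dr'.1 lr'.
have := sqrt_lipschitz mu0 SH SH' ls ls'; rewrite SS SS' => K.
have K2 : fnorm (rho - rho') <= D%:R * d%:C%C.
  by apply: fnorm_le_entries => i j; rewrite !mxE.
have {K K2} K := le_trans K K2.
have m2 : 0 < 2 * mu by rewrite mulr_gt0.
rewrite -(ler_pM2l m2); apply: le_trans K _.
rewrite (_ : 2 * mu * _ = D%:R * d%:C%C) //.
rewrite /mu -[2]/(2%:R) -!(rmorph_nat (real_complex R)) -!rmorphM /=.
by congr (_%:C%C); field; rewrite gt_eqF.
Qed.

Lemma fidelity_lipschitz rho rho' sigma sigma' (kr ks d : R) : 1 <= kr -> 1 <= ks ->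
  density rho -> density rho' -> density sigma -> density sigma' ->
  lowner ((kr^-1)%:C)%C%:M rho -> lowner ((kr^-1)%:C)%C%:M rho' ->
  lowner ((ks^-1)%:C)%C%:M sigma -> lowner ((ks^-1)%:C)%C%:M sigma' ->
  (forall i j, `|rho i j - rho' i j| <= d%:C%C) ->
  (forall i j, `|sigma i j - sigma' i j| <= d%:C%C) ->
  `|fidelity rho sigma - fidelity rho' sigma'| <= ((kr + ks) / 2 * (D%:R * d))%:C%C.
Proof.
move=> kr1 ks1 dr dr' ds ds' lr lr' ls ls' Hr Hs.
have unit (k : R) : 1 <= k -> 0 < ((k^-1)%:C%C : C) <= 1.
  move=> k1; have k0 : 0 < k by apply: lt_le_trans k1.
  by rewrite (ltcR 0) (lecR _ 1) invr_gt0 k0 invf_le1.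
have B : fnorm (sqrtm rho - sqrtm rho') + fnorm (sqrtm sigma - sqrtm sigma') <=
    ((kr + ks) / 2 * (D%:R * d))%:C%C.
  rewrite mulrDl mulrDl rmorphD; apply: lerD; exact: sqrtm_entries_le.
have B' : fnorm (sqrtm rho' - sqrtm rho) + fnorm (sqrtm sigma' - sqrtm sigma) <=
    ((kr + ks) / 2 * (D%:R * d))%:C%C.
  have Hr' i j : `|rho' i j - rho i j| <= d%:C%C by rewrite distrC.
  have Hs' i j : `|sigma' i j - sigma i j| <= d%:C%C by rewrite distrC.
  rewrite mulrDl mulrDl rmorphD; apply: lerD; exact: sqrtm_entries_le.
have K1 := fidelity_diff_le (unit _ kr1) (unit _ ks1) dr dr' ds ds' lr lr' ls ls'.
have K2 := fidelity_diff_le (unit _ kr1) (unit _ ks1) dr' dr ds' ds lr' lr ls' ls.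
have F0 := fidelity_ge0 dr.1 ds.1; have F0' := fidelity_ge0 dr'.1 ds'.1.
have {B}K1 := le_trans K1 B; have {B'}K2 := le_trans K2 B'.
move: (fidelity rho sigma) (fidelity rho' sigma') F0 F0' K1 K2 => F F' F0 F0' K1 K2.
by rewrite real_ler_norml ?realB ?ger0_real // lerNl opprB K1 K2.
Qed.
End FidelityLipschitz.

(** * Tomography *)

Section Tomography.
Context {R : realType} {D : nat}.
Local Notation C := (R[i]).

Definition probe_coef (b : bool) : C := if b then 'i else 1.

Definition probe_vec (s t : 'I_D) (b : bool) : 'cV[C]_D :=
  delta_mx s 0 + probe_coef b *: delta_mx t 0.

Definition probe (s t : 'I_D) (b : bool) : 'M[C]_D :=
  (((probe_vec s t b) ^t* *m probe_vec s t b) 0 0)^-1 *: outer (probe_vec s t b).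

Lemma probe_coef_norm b : (probe_coef b)^* * probe_coef b = 1.
Proof. by case: b; rewrite /= mulrC -normCK ?normCi ?normr1 expr1n. Qed.

Lemma dot_delta (M : 'M[C]_D) (s t : 'I_D) :
  ((delta_mx s 0 : 'cV[C]_D) ^t* *m (M *m (delta_mx t 0 : 'cV[C]_D))) 0 0 = M s t.
Proof.
rewrite mxE (bigD1 s) //= big1 => [|l lN]; rewrite !mxE ?eqxx ?(negPf lN) ?rmorph_nat ?mul0r //.
rewrite mul1r addr0 (bigD1 t) //= big1 => [|l lN]; rewrite !mxE ?eqxx ?(negPf lN) ?mulr0 //.
by rewrite mulr1 addr0.
Qed.

Lemma probe_quadE (M : 'M[C]_D) s t b :
  ((probe_vec s t b) ^t* *m (M *m probe_vec s t b)) 0 0 =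
    M s s + M t t + probe_coef b * M s t + (probe_coef b)^* * M t s.
Proof.
have trCD (u v : 'cV[C]_D) c : (u + c *: v) ^t* = u ^t* + c^* *: v ^t*.
  by apply/matrixP => i j; rewrite !mxE rmorphD rmorphM.
have addE (x y : 'M[C]_1) : (x + y) 0 0 = x 0 0 + y 0 0 by rewrite mxE.
have scaleE c (x : 'M[C]_1) : (c *: x) 0 0 = c * x 0 0 by rewrite mxE.
rewrite /probe_vec trCD mulmxDr mulmxDl !mulmxDr -!scalemxAr -!scalemxAl.
rewrite !addE !scaleE !dot_delta; move: (probe_coef_norm b).
move: (probe_coef b) (M s s) (M s t) (M t s) (M t t) => c u v w z cc.
by transitivity (u + c * v + (c^* * w + c^* * c * z)); [ring | rewrite cc; ring].
Qed.

(** For s = t the two cross terms cancel when the phase is i and add up to 2 when it is 1. *)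
Lemma probe_norm2 s t b :
  ((probe_vec s t b) ^t* *m probe_vec s t b) 0 0 = (2 + 2 * (~~ b && (s == t)))%:R.
Proof.
have := probe_quadE 1%:M s t b; rewrite mul1mx => ->.
rewrite !mxE !eqxx (eq_sym t); case: b => /=; last first.
  by case: eqP => _; rewrite ?muln1 ?muln0 conjC1 ?mul1r !natrD /=; ring.
by rewrite conjCi mulNr addrK muln0 addn0.
Qed.

Lemma probe_idem s t b : probe s t b *m probe s t b = probe s t b.
Proof.
rewrite /probe; set N := (_ *m _) 0 0.
have N0 : N != 0 by rewrite /N probe_norm2 pnatr_eq0.
rewrite -scalemxAl -scalemxAr scalerA /outer mulmxA -(mulmxA (probe_vec s t b)).
rewrite [_ ^t* *m probe_vec s t b]mx11_scalar -/N mul_mx_scalar -scalemxAl scalerA.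
by rewrite mulfVK.
Qed.

Lemma probe_herm s t b : (probe s t b) ^t* = probe s t b.
Proof.
rewrite /probe probe_norm2; apply/matrixP => i j; rewrite !mxE rmorphM fmorphV rmorph_nat.
congr (_ * _); have := outer_trC (probe_vec s t b).
by move=> /(congr1 (fun M : 'M[C]_D => M i j)); rewrite !mxE.
Qed.

Lemma tr_probeE (M : 'M[C]_D) s t b : \tr (probe s t b *m M) =
  (2 + 2 * (~~ b && (s == t)))%:R^-1 *
    (M s s + M t t + probe_coef b * M s t + (probe_coef b)^* * M t s).
Proof.
rewrite /probe probe_norm2 -scalemxAl linearZ /=; congr (_ * _).
by rewrite /outer -mulmxA mxtrace_mulC -mulmxA -probe_quadE /mxtrace big_ord1.
Qed.

(** Polarisation: probes with s = t give the diagonal, removing it bounds c M_st + conj(c) M_ts by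
    4d + 2d, and the phases c = 1 and c = i together isolate M_st. *)
Lemma tomography (M : 'M[C]_D) (d : C) : (forall s t b, `|\tr (probe s t b *m M)| <= d) ->
  forall s t, `|M s t| <= 6 * d.
Proof.
move=> H s t.
have diag i : `|M i i| <= d.
  have := H i i false; rewrite tr_probeE eqxx /= muln1 conjC1 !mul1r.
  by rewrite (_ : _ * _ = M i i) //; field.
have d0 : 0 <= d by exact: le_trans (normr_ge0 _) (diag s).
have quad b : `|probe_coef b * M s t + (probe_coef b)^* * M t s| <= 6 * d.
  have := H s t b; rewrite tr_probeE; set N : nat := (2 + _)%N; set q := _ + _ + _ + _ => Hq.
  have N0 : (N%:R : C) != 0 by rewrite pnatr_eq0.
  have -> : probe_coef b * M s t + (probe_coef b)^* * M t s = N%:R * (N%:R^-1 * q) - M s s - M t t.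
    by rewrite mulVKf // /q; ring.
  apply: le_trans (ler_normB _ _) _; rewrite (_ : 6 * d = 4 * d + d + d); last by ring.
  apply: lerD => //; apply: le_trans (ler_normB _ _) _; apply: lerD => //.
  rewrite normrM; apply: ler_pM => //; rewrite normr_nat ler_nat /N.
  by case: (_ && _).
have -> : M s t = 2^-1 * ((probe_coef false * M s t + (probe_coef false)^* * M t s)
   - 'i * (probe_coef true * M s t + (probe_coef true)^* * M t s)).
  have ii : 'i * 'i = -1 :> C by rewrite -expr2 sqrCi.
  rewrite /= conjC1 conjCi; move: (M s t) (M t s) => u v.
  rewrite (_ : _ - _ = u + v - ('i * 'i) * (u - v)); last by ring.
  by rewrite ii; field.
rewrite normrM ger0_norm ?invr_ge0 //.
rewrite -(ler_pM2l (ltr0Sn _ 1)) mulVKf ?pnatr_eq0 //.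
apply: le_trans (ler_normB _ _) _; rewrite (_ : 2 * (6 * d) = 6 * d + 6 * d); last by ring.
apply: lerD (quad false) _; rewrite normrM normCi mul1r; exact: quad.
Qed.
End Tomography.

(** * Decoding *)

Section Decoding.
Context {R : realType} (n m r : nat) (kr ks eps : R).
Hypotheses (m0 : (0 < m)%N) (r0 : (0 < r)%N) (kr1 : 1 <= kr) (ks1 : 1 <= ks).
Local Notation C := (R[i]).
Local Notation N := (2 ^ n)%N.

(* (state probed, s, t, probe phase, j, b): a coin of phase exponent 2^j + b *)
Definition group : Type :=
  (bool * 'I_N * 'I_N * bool * 'I_m.+1 * bool)%type.

Definition group_probe (g : group) : 'M[C]_N :=
  let: (_, s, t, c, _, _) := g in probe s t c.

Lemma group_idem g : group_probe g *m group_probe g = group_probe g.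
Proof. by case: g => [[[[[w s] t] c] j] b]; exact: probe_idem. Qed.

Lemma group_herm g : (group_probe g) ^t* = group_probe g.
Proof. by case: g => [[[[[w s] t] c] j] b]; exact: probe_herm. Qed.

Definition group_exp (g : group) : nat := let: (_, _, _, _, j, b) := g in (2 ^ j + b)%N.

Definition group_which (g : group) : bool := let: (w, _, _, _, _, _) := g in w.

Definition group_bias (rho sigma : 'M[C]_N) (g : group) : R :=
  bias (group_exp g) (expect (group_probe g) (if group_which g then rho else sigma)).

Definition admissible (p : 'M[C]_N * 'M[C]_N) : Prop :=
  [/\ density p.1, density p.2, lowner ((kr^-1)%:C)%C%:M p.1 & lowner ((ks^-1)%:C)%C%:M p.2].

(** Biases of two consistent candidates differ by at most 2 tol, hence the real parts of the phase
    powers by 4 tol = 2/(9m), the input of [phase_resolution]. *)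
Definition tol : R := (18 * m%:R)^-1.

Definition consistent (x : {ffun group * 'I_r -> bool}) (p : 'M[C]_N * 'M[C]_N) : bool :=
  [forall g : group, `|\sum_(l < r) ((x (g, l))%:R - group_bias p.1 p.2 g)| <= tol * r%:R].

Lemma consistent_bias_close x p p' g : consistent x p -> consistent x p' ->
  `|group_bias p.1 p.2 g - group_bias p'.1 p'.2 g| <= 2 * tol.
Proof.
move=> /forallP /(_ g) H /forallP /(_ g) H'.
have rR : 0 < (r%:R : R) by rewrite ltr0n.
have := le_trans (ler_normB _ _) (lerD H' H); rewrite -sumrB.
rewrite (eq_bigr (fun=> group_bias p.1 p.2 g - group_bias p'.1 p'.2 g)); last first.
  move=> l _; move: (group_bias _ _ g) (group_bias _ _ g) ((x _)%:R) => u v w.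
  by ring.
rewrite sumr_const card_ord -[X in `|X|]mulr_natr normrM (ger0_norm (ltW rR)).
by rewrite -mulrDl ler_pM2r // (_ : tol + tol = 2 * tol) //; ring.
Qed.

Lemma probe_expect_close x p p' (w : bool) s t c :
  admissible p -> admissible p' -> consistent x p -> consistent x p' ->
  `|expect (probe s t c) (if w then p.1 else p.2) -
    expect (probe s t c) (if w then p'.1 else p'.2)| <= 5 / 2 ^+ m.
Proof.
move=> [dr ds _ _] [dr' ds' _ _] cx cx'.
pose st (q : 'M[C]_N * 'M[C]_N) := if w then q.1 else q.2; rewrite -/(st p) -/(st p').
have dst : density (st p) by rewrite /st; case: (w).
have dst' : density (st p') by rewrite /st; case: (w).
have [_ p1] := expectE dst (probe_idem s t c) (probe_herm s t c).
have [_ p1'] := expectE dst' (probe_idem s t c) (probe_herm s t c).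
apply: phase_resolution => // j b jm.
have jm1 : (j < m.+1)%N by [].
have := consistent_bias_close (w, s, t, c, Ordinal jm1, b) cx cx'.
rewrite /group_bias /= -/(st p) -/(st p') !bias_phase //.
have mR : 1 <= (m%:R : R) by rewrite ler1n.
have -> : 2 * tol = 1 / 2 * (2 / (9 * m%:R)) by rewrite /tol; field; lra.
have aff (u v : R) : (1 + u) / 2 - (1 + v) / 2 = 1 / 2 * (u - v) by field.
by rewrite aff normrM ger0_norm ?ler_pM2l //; lra.
Qed.

Lemma consistent_fidelity_close x p p' : 15 * (kr + ks) * N%:R <= eps * 2 ^+ m ->
  admissible p -> admissible p' -> consistent x p -> consistent x p' ->
  `|fidelity p.1 p.2 - fidelity p'.1 p'.2| <= eps%:C%C.
Proof.
move=> Hm ap ap' cx cx'; have M0 : 0 < (2 : R) ^+ m by rewrite exprn_gt0.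
(* Tomography costs a factor 6 on the resolution 5/2^m; the Lipschitz constant (kr + ks)/2 times 30
   is the 15 (kr + ks) of the hypothesis. *)
pose d : R := 6 * (5 / 2 ^+ m).
have close (w : bool) i j : `|(if w then p.1 else p.2) i j - (if w then p'.1 else p'.2) i j| <= d%:C%C.
  set A : 'M[C]_N := if w then p.1 else p.2; set B : 'M[C]_N := if w then p'.1 else p'.2.
  have H s t b : `|\tr (probe s t b *m (A - B))| <= (5 / 2 ^+ m)%:C%C.
    have := probe_expect_close w s t b ap ap' cx cx'; move: ap ap' => [dr ds _ _] [dr' ds' _ _].
    have dA : density A by rewrite /A; case: (w).
    have dB : density B by rewrite /B; case: (w).
    rewrite -/A -/B mulmxBr linearB /=.
    have [-> _] := expectE dA (probe_idem s t b) (probe_herm s t b).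
    have [-> _] := expectE dB (probe_idem s t b) (probe_herm s t b).
    by rewrite -rmorphB normc_def /= expr0n addr0 sqrtr_sqr lecR.
  have -> : d%:C%C = 6 * (5 / 2 ^+ m)%:C%C :> C by rewrite /d rmorphM rmorph_nat.
  by have := tomography H i j; rewrite [X in `|X|]mxE [X in _ + X]mxE.
case: ap ap' => [dr ds lr ls] [dr' ds' lr' ls'].
have K := fidelity_lipschitz kr1 ks1 dr dr' ds ds' lr lr' ls ls' (close true) (close false).
apply: le_trans K _; rewrite lecR /d -(ler_pM2r M0); apply: le_trans Hm.
by rewrite le_eqVlt; apply/orP; left; apply/eqP; field; rewrite gt_eqF.
Qed.

(** Admissible pairs fitting the same outcomes have close fidelities, so the fidelity of an
    arbitrarily chosen one is accurate for the true pair as well. *)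
Lemma decoder : 15 * (kr + ks) * N%:R <= eps * 2 ^+ m ->
  exists out : {ffun group * 'I_r -> bool} -> R, forall x p,
    admissible p -> consistent x p -> `|(out x)%:C%C - fidelity p.1 p.2| <= eps%:C%C.
Proof.
move=> Hm; suff /choice [out outP] : forall x : {ffun group * 'I_r -> bool}, exists y : R,
    forall p, admissible p -> consistent x p -> `|y%:C%C - fidelity p.1 p.2| <= eps%:C%C.
  by exists out.
move=> x.
have [[p [ap cp]]|none] := pselect (exists p, admissible p /\ consistent x p); last first.
  (* When no admissible pair fits the outcomes the requirement is void; 0 is a default. *)
  by exists 0 => p ap cp; case: none; exists p.
exists (complex.Re (fidelity p.1 p.2)) => p' ap' cp'.
have F0 : 0 <= fidelity p.1 p.2 by case: ap => -[? _] [? _] _ _; exact: fidelity_ge0.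
have -> : (complex.Re (fidelity p.1 p.2))%:C%C = fidelity p.1 p.2.
  by apply: RRe_real; apply: ger0_real.
exact: (consistent_fidelity_close Hm ap ap' cp cp').
Qed.

Lemma group_bias01 p g : density p.1 -> density p.2 -> 0 <= group_bias p.1 p.2 g <= 1.
Proof.
move=> dr ds; rewrite /group_bias; case: g => [[[[[w s] t] c] j] b] /=.
have dst : density (if w then p.1 else p.2) by case: (w).
have [_ p1] := expectE dst (probe_idem s t c) (probe_herm s t c).
rewrite sqr_ge0 /= /bias -[leRHS](expr1n _ 2) -[leLHS]real_normK ?num_real //.
rewrite lerXn2r ?qualifE //=; apply: le_trans (abs_Re_le_normc _) _.
by rewrite normcX (zof_norm p1) expr1n.
Qed.

End Decoding.

(** Hoeffding for the r equal coins of each group, then a union bound over the groups, which number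
    2 N N 2 (m + 1) 2 with N = 2^n. *)
Lemma inconsistent_prob (R : realType) (n m r : nat) (p : 'M[R[i]]_(2 ^ n) * 'M[R[i]]_(2 ^ n)) :
  (0 < m)%N -> density p.1 -> density p.2 ->
  \sum_(x : {ffun group n m * 'I_r -> bool} | ~~ consistent x p) coin_law (fun i => group_bias p.1 p.2 i.1) x <=
    (8 * (2 ^ n) ^ 2 * m.+1)%:R * (2 * expR (- (r%:R * (tol m ^+ 2 / 8)))).
Proof.
move=> m0 dr ds; pose beta (i : (group n m * 'I_r)%type) := group_bias p.1 p.2 i.1.
have b01 i : 0 <= beta i <= 1 by exact: group_bias01.
pose A (g : group n m) : {set group n m * 'I_r} := [set (g, l) | l : 'I_r].
have cA g : #|A g| = r.
  by rewrite card_imset ?card_ord // => l l' [].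
have sA g (x : {ffun group n m * 'I_r -> bool}) : \sum_(i in A g) ((x i)%:R - beta i) =
    \sum_(l < r) ((x (g, l))%:R - group_bias p.1 p.2 g).
  by rewrite big_imset /=; [apply: eq_bigl => l; rewrite inE|move=> l l' _ _ []].
have mR : 1 <= (m%:R : R) by rewrite ler1n.
have t01 : 0 <= (tol m : R) <= 1.
  by rewrite /tol invr_ge0 invf_le1; [apply/andP; split; lra|lra].
apply: le_trans (_ : \sum_(g : group n m) \sum_(x : {ffun group n m * 'I_r -> bool} |
    tol m * #|A g|%:R < `|\sum_(i in A g) ((x i)%:R - beta i)|) coin_law beta x <= _).
  rewrite big_mkcond /=.
  under [X in _ <= X]eq_bigr => g _ do rewrite big_mkcond.
  rewrite exchange_big /=; apply: ler_sum => x _.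
  have pos g : 0 <= (if tol m * #|A g|%:R < `|\sum_(i in A g) ((x i)%:R - beta i)|
     then coin_law beta x else 0) by case: ifP => // _; exact: coin_law_ge0.
  case: ifP => [/forallPn [g Hg]|_]; last by apply: sumr_ge0.
  rewrite (bigD1 g) //= ifT; last by rewrite cA sA ltNge.
  by rewrite lerDl; apply: sumr_ge0.
apply: le_trans (_ : \sum_(g : group n m) 2 * expR (- (r%:R * (tol m ^+ 2 / 8))) <= _).
  by apply: ler_sum => g _; have := hoeffding b01 (A g) t01; rewrite cA.
rewrite sumr_const -[leLHS]mulr_natl; apply: ler_wpM2r; first by rewrite mulr_ge0 ?expR_ge0.
rewrite ler_nat !card_prod !card_bool !card_ord.
by rewrite expnS expn1; lia.
Qed.

(** * Accuracy and query count *)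

Section Budget.
Context {R : realType}.

Lemma logsz_gt (x : R) : 0 <= x -> x < 2 ^+ logsz x.
Proof.
move=> x0; apply: lt_le_trans (truncnS_gt x) _.
by rewrite -natrX ler_nat /logsz trunc_log_ltn.
Qed.

Lemma logsz_le (x : R) : 1 <= x -> 2 ^+ logsz x <= 2 * x.
Proof.
move=> x1; rewrite /logsz exprS ler_pM2l //.
have x0 : 0 <= x by apply: le_trans x1.
apply: le_trans (_ : (Num.truncn x)%:R <= _); last by rewrite truncn_le.
by rewrite -natrX ler_nat trunc_logP // truncn_gt0.
Qed.

(** Compare traces: 1 = Tr rho >= 2^n / k. This is how the condition numbers pay for tomography. *)
Lemma dim_le n (rho : 'M[R[i]]_(2 ^ n)) (k : R) : 0 < k -> density rho ->
  lowner ((k^-1)%:C)%C%:M rho -> (2 ^ n)%:R <= k.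
Proof.
move=> k0 [_ tr1] l; have := tr_congr_ge0 1%:M l.
rewrite trmx1 map_mx1 mul1mx mulmx1 linearB /= tr1 mxtrace_scalar subr_ge0.
by rewrite -rmorphMn (lecR _ 1) -[X in X <= 1]mulr_natl ler_pdivrMr // mul1r.
Qed.

Variables (n : nat) (kr ks eps : R).
Hypotheses (kr1 : 1 <= kr) (ks1 : 1 <= ks) (eps0 : 0 < eps) (eps1 : eps < 1).
Hypotheses (dkr : (2 ^ n)%:R <= kr) (dks : (2 ^ n)%:R <= ks).
Local Notation d := ((2 ^ n)%:R : R).

Definition precision : R := 15 * (kr + ks) * d / eps.
Definition levels : nat := logsz precision.
Local Notation m := levels.
(** Against tol = 1/(18m) this makes the Hoeffding exponent reps tol^2 / 8 equal to 3m. *)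
Definition reps : nat := (6 ^ 5 * m ^ 3)%N.

Lemma dim_ge1 : 1 <= d. Proof. by rewrite ler1n expn_gt0. Qed.

Lemma precision_ge : 30 * d <= precision.
Proof.
rewrite /precision ler_pdivlMr //; have := dim_ge1; move: d => D D1.
have [k1 s1 e0 e1] := And4 kr1 ks1 eps0 eps1.
apply: le_trans (_ : 30 * D * 1 <= _); first by apply: ler_wpM2l; lra.
have -> : 30 * D * 1 = 15 * 2 * D by ring.
by apply: ler_wpM2r; lra.
Qed.

Lemma levels_precise : 15 * (kr + ks) * d <= eps * 2 ^+ m.
Proof.
have p0 : 0 <= precision by have := precision_ge; have := dim_ge1; lra.
by rewrite [eps * _]mulrC -ler_pdivrMr //; exact/ltW/logsz_gt.
Qed.

Lemma levels_tight : 2 ^+ m <= 2 * precision.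
Proof. by apply: logsz_le; have := precision_ge; have := dim_ge1; lra. Qed.

(** With T the argument of [logsz] and L its value, 2^m <= 30 T^3 < 2^(5 + 3L), so m <= 4 + 3L <=
    7L. *)
Lemma levels_le : (m <= 7 * logsz (kr + ks + eps^-1))%N.
Proof.
set T := kr + ks + eps^-1; set L := logsz T.
have ei : 1 < eps^-1 by rewrite invf_gt1.
have [k1 s1] := conj kr1 ks1.
have T0 : 0 <= T by rewrite /T; lra.
have TL : T <= 2 ^+ L by apply/ltW/logsz_gt.
have L1 : (1 <= L)%N by [].
have P : 2 * precision <= 30 * T ^+ 3.
  have -> : 2 * precision = 30 * (kr + ks) * d * eps^-1 by rewrite /precision; ring.
  have dT : d <= T by apply: le_trans dkr _; rewrite /T; lra.
  have -> : 30 * T ^+ 3 = 30 * T * T * T by ring.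
  have d1 := dim_ge1.
  have d0 : 0 <= d by lra.
  have s0 : 0 <= 30 * (kr + ks) by lra.
  apply: ler_pM; [exact: mulr_ge0 | lra | | rewrite /T; lra].
  by apply: ler_pM => //; rewrite ler_pM2l // /T; lra.
have : (2 : R) ^+ m < 2 ^+ (5 + L * 3).
  apply: le_lt_trans levels_tight _; apply: le_lt_trans P _.
  rewrite exprD exprM; apply: (@le_lt_trans _ _ (30 * (2 ^+ L) ^+ 3)).
    by rewrite ler_pM2l // lerXn2r ?qualifE /= ?exprn_ge0.
  by rewrite ltr_pM2r ?exprn_gt0 // !exprS expr0; lra.
rewrite ltr_eXn2l; last lra.
by move: L1; move: (L) m => b a; lia.
Qed.

(** The factor e^(-3m) <= 2^(-3m) absorbs the group count: d <= 2^m / 30 and m + 1 <= 2^m leave at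
    most 16/900. *)
Lemma failure_le : (8 * (2 ^ n) ^ 2 * m.+1)%:R *
   (2 * expR (- (reps%:R * (@tol R m ^+ 2 / 8)))) <= 1 / 3.
Proof.
have mR : 1 <= (m%:R : R) by rewrite ler1n.
have -> : reps%:R * (@tol R m ^+ 2 / 8) = (3 * m)%:R * 1.
  rewrite /reps /tol natrM !natrX natrM; field; lra.
rewrite expRN expRM_natl.
have e1 : 2 <= expR (1 : R) by apply: le_trans (expR_ge1Dx 1); lra.
have e3 : (2 : R) ^+ m ^+ 3 <= expR 1 ^+ (3 * m).
  by rewrite mulnC -exprM lerXn2r ?qualifE /= ?expR_ge0.
have M0 : 0 < (2 : R) ^+ m by rewrite exprn_gt0.
have M30 : 30 * d <= 2 ^+ m.
  apply: le_trans precision_ge _; apply/ltW/logsz_gt.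
  by have := precision_ge; have := dim_ge1; lra.
have Mm : (m.+1)%:R <= (2 : R) ^+ m by rewrite -natrX ler_nat ltn_expl.
have I : (expR 1 ^+ (3 * m))^-1 <= ((2 : R) ^+ m ^+ 3)^-1.
  by rewrite lef_pV2 // posrE ?exprn_gt0 // expR_gt0.
rewrite natrM natrM natrX.
have d1 := dim_ge1.
apply: le_trans (_ : 8 * d ^+ 2 * m.+1%:R * (2 * ((2 : R) ^+ m ^+ 3)^-1) <= _).
  by apply: ler_wpM2l; rewrite ?mulr_ge0 ?exprn_ge0 ?ler0n // ler_pM2l.
have m1 : 0 <= (m.+1%:R : R) by [].
move: (2 ^+ m) (m.+1%:R) m1 M0 M30 Mm => M k k0 M0 M30 kM.
rewrite mulrA -[_ * _^-1]/(_ / _) ler_pdivrMr ?exprn_gt0 //.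
have : d ^+ 2 * k <= (M / 30) ^+ 2 * M.
  by apply: ler_pM => //; rewrite ?exprn_ge0 ?lerXn2r ?qualifE //= ?ler_pdivlMr //; lra.
by have := exprn_gt0 3 M0; rewrite !exprS expr0; move: (d * _) => D; lra.
Qed.

(** Groups times repetitions times queries per coin. The dimension enters as d^3 (kr + ks), with d^2
    from the probes and d from the precision: d^3 is at most the cube of the smaller condition
    number, and kr + ks at most twice the larger. The fourth logarithmic power comes from m + 1
    groups and m^3 repetitions. *)
Lemma budget_le : (8 * (2 ^ n) ^ 2 * m.+1 * reps * (4 * 2 ^ m))%:R <=
  (6 ^+ 5 * (8 * 2 * 4 * 2 * 15 * 2) * 7 ^+ 4) * (Num.min (kr ^+ 2) (ks ^+ 2) * kr * ks / eps)
    * (logsz (kr + ks + eps^-1))%:R ^+ 4 :> R.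
Proof.
have mR : 1 <= (m%:R : R) by rewrite ler1n.
have d1 := dim_ge1.
have mL : (m%:R : R) <= 7 * (logsz (kr + ks + eps^-1))%:R by rewrite -natrM ler_nat levels_le.
have cost : d ^+ 3 * (kr + ks) <= 2 * (Num.min (kr ^+ 2) (ks ^+ 2) * kr * ks).
  have [a1 b1 a2 b2] := And4 kr1 ks1 dkr dks.
  have [kk|kk] := lerP kr ks.
    have -> : Num.min (kr ^+ 2) (ks ^+ 2) = kr ^+ 2.
      by apply/min_idPl; rewrite lerXn2r ?qualifE //=; lra.
    have -> : 2 * (kr ^+ 2 * kr * ks) = kr ^+ 3 * (2 * ks) by ring.
    by apply: ler_pM; rewrite ?exprn_ge0 ?lerXn2r ?qualifE //=; lra.
  have -> : Num.min (kr ^+ 2) (ks ^+ 2) = ks ^+ 2.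
    by apply/min_idPr; rewrite lerXn2r ?qualifE //=; lra.
  have -> : 2 * (ks ^+ 2 * kr * ks) = ks ^+ 3 * (2 * kr) by ring.
  by apply: ler_pM; rewrite ?exprn_ge0 ?lerXn2r ?qualifE //=; lra.
have -> : (8 * (2 ^ n) ^ 2 * m.+1 * reps * (4 * 2 ^ m))%:R =
    8 * d ^+ 2 * (m.+1)%:R * (6 ^+ 5 * m%:R ^+ 3) * (4 * 2 ^+ m) :> R.
  by rewrite /reps !natrM !natrX.
have T := levels_tight; have e0 := eps0.
set L := (logsz _)%:R in mL *.
set Q := Num.min _ _ * kr * ks in cost *.
apply: le_trans (_ : 8 * d ^+ 2 * (2 * m%:R) * (6 ^+ 5 * m%:R ^+ 3) * (4 * (2 * precision)) <= _).
  apply: ler_pM; rewrite ?mulr_ge0 ?exprn_ge0 ?ler0n //; last by rewrite ler_pM2l.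
  rewrite ler_wpM2r ?mulr_ge0 ?exprn_ge0 ?ler0n //.
  by rewrite ler_wpM2l ?mulr_ge0 ?exprn_ge0 ?ler0n // -natr1; lra.
have -> : 8 * d ^+ 2 * (2 * m%:R) * (6 ^+ 5 * m%:R ^+ 3) * (4 * (2 * precision)) =
    6 ^+ 5 * (8 * 2 * 4 * 2 * 15) * (d ^+ 3 * (kr + ks)) / eps * m%:R ^+ 4.
  by rewrite /precision; ring.
have -> : (6 ^+ 5 * (8 * 2 * 4 * 2 * 15 * 2) * 7 ^+ 4) * (Q / eps) * L ^+ 4 =
    6 ^+ 5 * (8 * 2 * 4 * 2 * 15) * (2 * Q) / eps * (7 * L) ^+ 4 by ring.
have k0 : 0 <= kr + ks by have [a1 b1] := conj kr1 ks1; lra.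
apply: ler_pM.
- by rewrite divr_ge0 ?(ltW e0) // !mulr_ge0 ?exprn_ge0.
- by rewrite exprn_ge0.
- by rewrite ler_pM2r ?invr_gt0 // ler_wpM2l // !mulr_ge0 ?exprn_ge0.
- by rewrite lerXn2r ?qualifE //=; lra.
Qed.
End Budget.

(** * The algorithm *)

Lemma fidelity_algorithm (R : realType) (n ar as_ : nat) (kr ks eps : R) :
  1 <= kr -> 1 <= ks -> 0 < eps -> eps < 1 ->
  (2 ^ n)%:R <= kr -> (2 ^ n)%:R <= ks ->
  exists A : @query_algo R,
    [/\ valid_algo (n + ar) (n + as_) A,
        (num_queries A)%:R <=
          (6 ^+ 5 * (8 * 2 * 4 * 2 * 15 * 2) * 7 ^+ 4) *
          (Num.min (kr ^+ 2) (ks ^+ 2) * kr * ks / eps)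
            * (logsz (kr + ks + eps^-1))%:R ^+ 4 &
        forall (rho sigma : 'M[R[i]]_(2 ^ n)) (Orho : 'M[R[i]]_(2 ^ (n + ar)))
          (Osig : 'M[R[i]]_(2 ^ (n + as_))),
        density rho -> density sigma ->
        lowner ((kr^-1)%:C)%C%:M rho -> lowner ((ks^-1)%:C)%C%:M sigma ->
        prepares_purification Orho rho -> prepares_purification Osig sigma ->
        (2 / 3 : R)%:C%C <=
          prob_out Orho Osig A
            (fun x : R => `|(x%:C)%C - fidelity rho sigma| <= (eps%:C)%C)].
Proof.
move=> kr1 ks1 e0 e1 dkr dks.
pose m := levels n kr ks eps; pose r := reps n kr ks eps.
have m0 : (0 < m)%N by [].
have r0 : (0 < r)%N by rewrite /r /reps muln_gt0 !expn_gt0 m0.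
have [D HD] := fin_all_exists (fun i : (group n m * 'I_r)%type => @coin_realizable R n ar as_ (group_which i.1)
  (group_probe (R := R) i.1) (group_exp i.1) (group_idem i.1) (group_herm i.1)).
have [out outP] := @decoder R n m r kr ks eps m0 r0 kr1 ks1 (levels_precise n kr1 ks1 e0 e1).
have [A [vA qA pA]] := realizes_algo out (realizes_ffun (fun i => (HD i).1)).
exists A; split=> //.
  apply: le_trans (budget_le kr1 ks1 e0 e1 dkr dks); rewrite qA ler_nat.
  (* Exponents are at most 2^m + 1 <= 2^(m+1), with two queries per walk step. *)
  apply: leq_trans (_ : \sum_(i : (group n m * 'I_r)%type) 4 * 2 ^ m <= _)%N.
    apply: leq_sum => -[[[[[[w s] t] c] j] b] l] _ /=.
    have : (2 ^ j <= 2 ^ m)%N by rewrite leq_pexp2l // -ltnS.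
    have : (0 < 2 ^ m)%N by rewrite expn_gt0.
    by case: b; move: (2 ^ j)%N (2 ^ m)%N => u v; lia.
  rewrite sum_nat_const leq_mul2r; apply/orP; right.
  rewrite !card_prod !card_bool !card_ord -/m -/r leq_mul2r; apply/orP; right.
  by rewrite expnS expn1; move: (2 ^ n)%N => u; lia.
move=> rho sigma Orho Osig dr ds lr ls pr ps.
pose beta (i : (group n m * 'I_r)%type) := @group_bias R n m rho sigma i.1.
have adm : admissible kr ks (rho, sigma) := And4 dr ds lr ls.
have b01 (i : (group n m * 'I_r)%type) : 0 <= beta i <= 1 by exact: (@group_bias01 R n m (rho, sigma)).
rewrite pA; pose good (x : {ffun (group n m * 'I_r)%type -> bool}) := consistent x (rho, sigma).
have lawE (x : {ffun (group n m * 'I_r)%type -> bool}) : \prod_i D i Orho Osig (x i) = (coin_law beta x)%:C%C.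
  rewrite /coin_law rmorph_prod; apply: eq_bigr => i _.
  by rewrite ((HD i).2 _ _ rho sigma) // /beta /group_bias; case: (x i).
(* The output is accurate whenever the outcomes are consistent with the true pair, which fails with
   probability at most 1/3. *)
apply: le_trans (_ : (\sum_(x : {ffun (group n m * 'I_r)%type -> bool} | good x) coin_law beta x)%:C%C <= _).
  rewrite lecR; have := coin_law_total beta; rewrite (bigID good) /= => tot.
  have := @inconsistent_prob R n m r (rho, sigma) m0 dr ds.
  have := failure_le n kr1 ks1 e0 e1; rewrite -/m -/r -/beta.
  by move=> H1 H2; have H := le_trans H2 H1; lra.
rewrite rmorph_sum big_mkcond [X in _ <= X]big_mkcond /=; apply: ler_sum => x _.
rewrite lawE; case: ifP => [gx|_].
  by rewrite ifT //; exact: (outP x (rho, sigma)).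
by case: ifP => // _; rewrite ler0c coin_law_ge0.
Qed.

Unset Implicit Arguments.

Theorem mainTheorem9 (R : realType) :
  exists (c : R) (k : nat),
  forall (n ar as_ : nat) (kr ks eps : R),
    1 <= kr -> 1 <= ks -> 0 < eps -> eps < 1 ->
    exists A : @query_algo R,
      valid_algo (n + ar) (n + as_) A /\
      (num_queries A)%:R
        <= c * (Num.min (kr ^+ 2) (ks ^+ 2) * kr * ks / eps)
             * (logsz (kr + ks + eps^-1))%:R ^+ k /\
      forall (rho sigma : 'M[R[i]]_(2 ^ n))
             (Orho : 'M[R[i]]_(2 ^ (n + ar))) (Osig : 'M[R[i]]_(2 ^ (n + as_))),
        density rho -> density sigma ->
        lowner ((kr^-1)%:C)%C%:M rho -> lowner ((ks^-1)%:C)%C%:M sigma ->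
        prepares_purification Orho rho -> prepares_purification Osig sigma ->
        (2 / 3 : R)%:C%C <=
          prob_out Orho Osig A
            (fun x : R => `|(x%:C)%C - fidelity rho sigma| <= (eps%:C)%C).
Proof.
exists (6 ^+ 5 * (8 * 2 * 4 * 2 * 15 * 2) * 7 ^+ 4), 4%N => n ar as_ kr ks eps kr1 ks1 e0 e1.
(* The test involves only parameters known in advance, so the choice of circuit may depend on it. *)
case: (boolP (((2 ^ n)%:R <= kr) && ((2 ^ n)%:R <= ks))) => [/andP [dkr dks]|big].
  have [A [vA qA pA]] := fidelity_algorithm ar as_ kr1 ks1 e0 e1 dkr dks.
  by exists A.
(* Otherwise no state meets the hypotheses and any algorithm will do. *)
have [A [vA qA _]] := realizes_algo (fun=> 0 : R) (realizes_point (n + ar) (n + as_) tt).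
exists A; split=> //; split.
  rewrite qA !mulr_ge0 ?exprn_ge0 ?ler0n ?invr_ge0 ?(ltW e0) //; try by apply: le_trans kr1.
  all: try by apply: le_trans ks1.
  by rewrite le_min !exprn_ge0 //; [apply: le_trans ks1|apply: le_trans kr1].
move=> rho sigma Orho Osig dr ds lr ls _ _; case/negP: big.
have k0 : 0 < kr by apply: lt_le_trans kr1.
have s0 : 0 < ks by apply: lt_le_trans ks1.
by rewrite (dim_le k0 dr lr) (dim_le s0 ds ls).
Qed.
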